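(* Let $0\leqslant m\leqslant n$, $1\leqslant l\leqslant n-1$, and $1\leqslant a_1<\dots<a_m\leqslant n$. Consider the standard basis vector $v(a_1,\dots,a_m)$ of $S_{((n-m),(1^m))}$. Then $\psi_l v(a_1,\dots,a_m)=0$ except in the following cases. (i) Suppose that $a_r=l$ for some $1\leqslant r\leqslant m$, and that either $r=m$ or $a_{r+1}\geqslant l+2$. Then $$\psi_l v(a_1,\dots,a_m)=v(a_1,\dots,a_{r-1},l+1,a_{r+1},\dots,a_m).$$ (ii) Suppose that $l\equiv\kappa_2-\kappa_1\pmod e$ and $l<n-1$. - Suppose $a_r=l+1$ and $a_{r+1}=l+2$ for some $1\leqslant r\leqslant m-1$, and that either $r=1$ or $a_{r-1}\leqslant l-1$. Then $$\psi_l v(a_1,\dots,a_m)=v(a_1,\dots,a_{r-1},l,l+1,a_{r+2},\dots,a_m).$$ - Suppose $a_r=l+2$ for some $1\leqslant r\leqslant m$, and that either $r=1$ or $a_{r-1}\leqslant l-1$. Then $$\psi_l v(a_1,\dots,a_m)=-v(a_1,\dots,a_{r-1},l,a_{r+1},\dots,a_m).$$ (iii) Suppose that $l\equiv 2+\kappa_2-\kappa_1\pmod e$. - Suppose $a_r=l$ and $a_{r+1}=l+1$ for some $1\leqslant r\leqslant m-1$, and that either $r=1$ or $a_{r-1}\leqslant l-2$. Then $$\psi_l v(a_1,\dots,a_m)=v(a_1,\dots,a_{r-1},l-1,l,a_{r+2},\dots,a_m).$$ - Suppose $a_r=l+1$ for some $1\leqslant r\leqslant m$, and that either $r=1$ or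 $a_{r-1}\leqslant l-2$. Then $$\psi_l v(a_1,\dots,a_m)=-v(a_1,\dots,a_{r-1},l-1,a_{r+1},\dots,a_m).$$ (iv) Suppose that $l+\kappa_1-\kappa_2\not\equiv 0,1,2\pmod e$, $a_r=l+1$ for some $1\leqslant r\leqslant m$, and either $r=1$ or $a_{r-1}\leqslant l-1$. Then $$\psi_l v(a_1,\dots,a_m)=v(a_1,\dots,a_{r-1},l,a_{r+1},\dots,a_m).$$
   Context: Let $\mathbb F$ be a field, $e\geqslant 3$ an integer, $I=\mathbb Z/e\mathbb Z$, $n\geqslant 1$ an integer and $\kappa=(\kappa_1,\kappa_2)\in I^2$. For $i,j\in I$ write $i\to j$ if $j=i+1$ and $i\leftarrow j$ if $j=i-1$. The symmetric group $\mathfrak S_n$, with $s_r=(r,r+1)$, acts on $I^n$ by place permutations. Algebra. $\mathscr H_n$ is the unital associative $\mathbb F$-algebra with generators $e(\mathbf i)$ ($\mathbf i\in I^n$), $y_1,\dots,y_n$, $\psi_1,\dots,\psi_{n-1}$ and relations: $e(\mathbf i)e(\mathbf j)=\delta_{\mathbf i,\mathbf j}e(\mathbf i)$; $\sum_{\mathbf i}e(\mathbf i)=1$; $y_re(\mathbf i)=e(\mathbf i)y_r$; $\psi_re(\mathbf i)=e(s_r\mathbf i)\psi_r$; $y_ry_s=y_sy_r$; $\psi_ry_s=y_s\psi_r$ if $s\ne r,r+1$; $\psi_r\psi_s=\psi_s\psi_r$ if $|r-s|>1$; $\psi_ry_{r+1}e(\mathbf i)=(y_r\psi_r+\delta_{i_r,i_{r+1}})e(\mathbf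 i)$; $y_{r+1}\psi_re(\mathbf i)=(\psi_ry_r+\delta_{i_r,i_{r+1}})e(\mathbf i)$; $\psi_r^2e(\mathbf i)$ equals $0$ if $i_r=i_{r+1}$, $(y_{r+1}-y_r)e(\mathbf i)$ if $i_r\to i_{r+1}$, $(y_r-y_{r+1})e(\mathbf i)$ if $i_r\leftarrow i_{r+1}$, and $e(\mathbf i)$ otherwise; $\psi_r\psi_{r+1}\psi_re(\mathbf i)$ equals $(\psi_{r+1}\psi_r\psi_{r+1}+1)e(\mathbf i)$ if $i_{r+2}=i_r\to i_{r+1}$, $(\psi_{r+1}\psi_r\psi_{r+1}-1)e(\mathbf i)$ if $i_{r+2}=i_r\leftarrow i_{r+1}$, and $\psi_{r+1}\psi_r\psi_{r+1}e(\mathbf i)$ otherwise. The cyclotomic algebra $\mathscr H_n^\Lambda$ (level 2) is the quotient of $\mathscr H_n$ by the relations $y_1^{c(i_1)}e(\mathbf i)=0$ for all $\mathbf i\in I^n$, where $c(i)=\#\{j\in\{1,2\}:\kappa_j=i\}$. Specht modules labelled by hook bipartitions. For $0\leqslant m\leqslant n$ put $\mathbf i_{((n-m),(1^m))}=(\kappa_2,\kappa_2-1,\dots,\kappa_2-m+1,\kappa_1,\kappa_1+1,\dots,\kappa_1+n-m-1)\in I^n$. The Specht module $S_{((n-m),(1^m))}$ is the $\mathscr H_n$-module generated by $z=z_{((n-m),(1^m))}$ subject only to $e(\mathbf i_{((n-m),(1^m))})z=z$, $y_rz=0$ for $1\leqslant r\leqslant n$, and $\psi_rz=0$ for all $r\in\{1,\dots,n-1\}\setminus\{m\}$;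 it is an $\mathscr H_n^\Lambda$-module. For $1\leqslant a_1<\dots<a_m\leqslant n$ define $$v(a_1,\dots,a_m)=(\psi_{a_1-1}\psi_{a_1-2}\cdots\psi_1)(\psi_{a_2-1}\cdots\psi_2)\cdots(\psi_{a_m-1}\cdots\psi_m)\,z,$$ where indices decrease in each factor and the factor $\psi_{a_j-1}\cdots\psi_j$ is $1$ if $a_j=j$. These vectors form an $\mathbb F$-basis of $S_{((n-m),(1^m))}$ (the standard basis); $v(a_1,\dots,a_m)$ is labelled by the standard $((n-m),(1^m))$-tableau whose leg (second component) has entries $a_1,\dots,a_m$ from top to bottom.
   Formalization: Both parts of case (iii) additionally require l ≥ 2: for l = 1 the stated right-hand side would be v(0,…), which is not defined (leg entries must be at least 1); for l = 1 these vectors fall under ψ_l v = 0. *)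

(* Defs.v *)
From HB Require Import structures.
From mathcomp Require Import all_boot all_algebra.
From mathcomp Require Import ring_quotient boolp.
From mathcomp Require Import monalg.

Set Implicit Arguments.
Unset Strict Implicit.
Unset Printing Implicit Defensive.

Import GRing.Theory.
Import Quotient.

Local Open Scope ring_scope.
Local Open Scope quotient_scope.

Section RingByRelations.
Variables (A : pzRingType) (rel : A -> A -> Prop).

Inductive two_sided_ideal : A -> Prop :=
| tsi_rel x y : rel x y -> two_sided_ideal (x - y)
| tsi_0 : two_sided_ideal 0
| tsi_sub x y : two_sided_ideal x -> two_sided_ideal y ->
    two_sided_ideal (x - y)
| tsi_mull a x : two_sided_ideal x -> two_sided_ideal (a * x)
| tsi_mulr a x : two_sided_ideal x -> two_sided_ideal (x * a).

Definition tsideal : {pred A} := fun x => `[< two_sided_ideal x >].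

Fact tsideal_zmod_closed : zmod_closed tsideal.
Proof.
split=> [|x y /asboolP xI /asboolP yI]; apply/asboolP; first exact: tsi_0.
exact: tsi_sub.
Qed.
HB.instance Definition _ := GRing.isZmodClosed.Build A tsideal
  tsideal_zmod_closed.

Definition quotient_ring := {quot tsideal}.
HB.instance Definition _ := GRing.Zmodule.on quotient_ring.

Definition ring_class (x : A) : quotient_ring := \pi_{quot tsideal} x.

Lemma ring_classP x y :
  ring_class x = ring_class y <-> two_sided_ideal (x - y).
Proof.
rewrite /ring_class; split=> [/eqP|xyI].
  by rewrite piE equivE => /asboolP.
by apply/eqP; rewrite piE equivE; apply/asboolP.
Qed.

Lemma ring_class_rel x y : rel x y -> ring_class x = ring_class y.
Proof. by move=> xy; apply/ring_classP/tsi_rel. Qed.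

Lemma ring_class_repr (u : quotient_ring) : ring_class (repr u) = u.
Proof. exact: reprK. Qed.

Lemma ring_class_is_zmod_morphism : zmod_morphism ring_class.
Proof. by move=> x y; rewrite /ring_class raddfB. Qed.
HB.instance Definition _ := GRing.isZmodMorphism.Build A quotient_ring
  ring_class ring_class_is_zmod_morphism.

Definition quotient_mul (u v : quotient_ring) : quotient_ring :=
  locked (ring_class (repr u * repr v)).

Lemma ring_classM x y :
  ring_class (x * y) = quotient_mul (ring_class x) (ring_class y).
Proof.
set x' := repr (ring_class x); set y' := repr (ring_class y).
have xx' : two_sided_ideal (x - x').
  by apply/ring_classP; rewrite ring_class_repr.
have yy' : two_sided_ideal (y - y').
  by apply/ring_classP; rewrite ring_class_repr.
rewrite /quotient_mul -lock; apply/ring_classP; rewrite -/x' -/y'.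
have -> : x * y - x' * y' = (x - x') * y - x' * (y' - y).
  by rewrite mulrBl mulrBr opprB addrA subrK.
apply: tsi_sub; first exact: tsi_mulr.
by apply: tsi_mull; rewrite -opprB -sub0r; apply: tsi_sub => //; apply: tsi_0.
Qed.

Fact quotient_mulA : associative quotient_mul.
Proof.
move=> u v w; rewrite -[u]ring_class_repr -[v]ring_class_repr.
by rewrite -[w]ring_class_repr -!ring_classM mulrA.
Qed.
Fact quotient_mul1 : left_id (ring_class 1) quotient_mul.
Proof. by move=> u; rewrite -[u]ring_class_repr -ring_classM mul1r. Qed.
Fact quotient_mulr1 : right_id (ring_class 1) quotient_mul.
Proof. by move=> u; rewrite -[u]ring_class_repr -ring_classM mulr1. Qed.
Fact quotient_mulDl : left_distributive quotient_mul +%R.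
Proof.
move=> u v w; rewrite -[u]ring_class_repr -[v]ring_class_repr.
by rewrite -[w]ring_class_repr -raddfD -!ring_classM -raddfD mulrDl.
Qed.
Fact quotient_mulDr : right_distributive quotient_mul +%R.
Proof.
move=> u v w; rewrite -[u]ring_class_repr -[v]ring_class_repr.
by rewrite -[w]ring_class_repr -raddfD -!ring_classM -raddfD mulrDr.
Qed.
HB.instance Definition _ := GRing.Zmodule_isPzRing.Build quotient_ring
  quotient_mulA quotient_mul1 quotient_mulr1 quotient_mulDl quotient_mulDr.

Lemma ring_class_is_monoid_morphism : monoid_morphism ring_class.
Proof. by split=> // x y; rewrite ring_classM. Qed.
HB.instance Definition _ := GRing.isMonoidMorphism.Build A quotient_ring
  ring_class ring_class_is_monoid_morphism.

End RingByRelations.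

(* The quotient of an F-algebra is again one. It is only given the ring and
   module structures, since algType also requires 1 != 0. *)
Section AlgebraByRelations.
Variables (F : comNzRingType) (A : algType F) (rel : A -> A -> Prop).
Local Notation Q := (quotient_ring rel).

Definition quotient_scale (c : F) (u : Q) : Q := ring_class rel (c%:A) * u.

Fact quotient_scaleA a b u :
  quotient_scale a (quotient_scale b u) = quotient_scale (a * b) u.
Proof.
rewrite /quotient_scale mulrA -rmorphM.
by rewrite -scalerAl mul1r scalerA.
Qed.
Fact quotient_scale1 : left_id 1 quotient_scale.
Proof. by move=> u; rewrite /quotient_scale scale1r rmorph1 mul1r. Qed.
Fact quotient_scaleDr : right_distributive quotient_scale +%R.
Proof. by move=> a u v; rewrite /quotient_scale mulrDr. Qed.
Fact quotient_scaleDl u : {morph quotient_scale^~ u : a b / a + b}.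
Proof. by move=> a b; rewrite /quotient_scale scalerDl rmorphD mulrDl. Qed.
HB.instance Definition _ := GRing.Zmodule_isLmodule.Build F (quotient_ring rel)
  quotient_scaleA quotient_scale1 quotient_scaleDr quotient_scaleDl.

Lemma ring_classZ c x : ring_class rel (c *: x) = c *: ring_class rel x.
Proof.
rewrite -[RHS]/(quotient_scale c _) /quotient_scale -rmorphM.
by rewrite -scalerAl mul1r.
Qed.

Lemma quotient_scaleAl (c : F) (u v : Q) : c *: (u * v) = (c *: u) * v.
Proof.
by rewrite -![_ *: _ in LHS]/(quotient_scale c _) /quotient_scale mulrA.
Qed.

Lemma quotient_scaleAr (c : F) (u v : Q) : c *: (u * v) = u * (c *: v).
Proof.
rewrite -[u]ring_class_repr -[v]ring_class_repr.
by rewrite -rmorphM -!ring_classZ -rmorphM scalerAr.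
Qed.

End AlgebraByRelations.

(* The left A-module generated by one element z subject to the relations
   x z = y z for rel x y, realized as A modulo a left ideal, z being the
   class of 1. *)
Section CyclicModule.
Variables (A : pzRingType) (rel : A -> A -> Prop).

Inductive left_ideal : A -> Prop :=
| li_rel x y : rel x y -> left_ideal (x - y)
| li_0 : left_ideal 0
| li_sub x y : left_ideal x -> left_ideal y -> left_ideal (x - y)
| li_mull a x : left_ideal x -> left_ideal (a * x).

Definition lideal : {pred A} := fun x => `[< left_ideal x >].

Fact lideal_zmod_closed : zmod_closed lideal.
Proof.
split=> [|x y /asboolP xI /asboolP yI]; apply/asboolP; first exact: li_0.
exact: li_sub.
Qed.
HB.instance Definition _ := GRing.isZmodClosed.Build A lideal
  lideal_zmod_closed.

Definition cyclic_module := {quot lideal}.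
HB.instance Definition _ := GRing.Zmodule.on cyclic_module.

Definition module_class (x : A) : cyclic_module := \pi_{quot lideal} x.

Lemma module_classP x y :
  module_class x = module_class y <-> left_ideal (x - y).
Proof.
rewrite /module_class; split=> [/eqP|xyI].
  by rewrite piE equivE => /asboolP.
by apply/eqP; rewrite piE equivE; apply/asboolP.
Qed.

Lemma module_class_repr (u : cyclic_module) : module_class (repr u) = u.
Proof. exact: reprK. Qed.

Lemma module_class_is_zmod_morphism : zmod_morphism module_class.
Proof. by move=> x y; rewrite /module_class raddfB. Qed.
HB.instance Definition _ := GRing.isZmodMorphism.Build A cyclic_module
  module_class module_class_is_zmod_morphism.

Definition cyclic_scale (a : A) (u : cyclic_module) : cyclic_module :=
  locked (module_class (a * repr u)).

Lemma module_classM a x :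
  module_class (a * x) = cyclic_scale a (module_class x).
Proof.
rewrite /cyclic_scale -lock; apply/module_classP; rewrite -mulrBr.
apply: li_mull.
by apply/module_classP; rewrite module_class_repr.
Qed.

Fact cyclic_scaleA a b u :
  cyclic_scale a (cyclic_scale b u) = cyclic_scale (a * b) u.
Proof. by rewrite -[u]module_class_repr -!module_classM mulrA. Qed.
Fact cyclic_scale1 : left_id 1 cyclic_scale.
Proof. by move=> u; rewrite -[u]module_class_repr -module_classM mul1r. Qed.
Fact cyclic_scaleDr : right_distributive cyclic_scale +%R.
Proof.
move=> a u v; rewrite -[u]module_class_repr -[v]module_class_repr.
by rewrite -raddfD -!module_classM -raddfD mulrDr.
Qed.
Fact cyclic_scaleDl u : {morph cyclic_scale^~ u : a b / a + b}.
Proof.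
move=> a b; rewrite -[u]module_class_repr -!module_classM.
by rewrite -raddfD mulrDl.
Qed.
HB.instance Definition _ := GRing.Zmodule_isLmodule.Build A cyclic_module
  cyclic_scaleA cyclic_scale1 cyclic_scaleDr cyclic_scaleDl.

Definition cyclic_gen : cyclic_module := module_class 1.

Lemma cyclic_genP x y :
  x *: cyclic_gen = y *: cyclic_gen <-> left_ideal (x - y).
Proof.
have genE w : w *: cyclic_gen = module_class w.
  by rewrite -[w in RHS]mulr1 module_classM.
by rewrite !genE; apply: module_classP.
Qed.

Lemma cyclic_gen_rel x y : rel x y -> x *: cyclic_gen = y *: cyclic_gen.
Proof. by move=> xy; apply/cyclic_genP/li_rel. Qed.

Lemma cyclic_gen_generates (u : cyclic_module) : exists x, u = x *: cyclic_gen.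
Proof.
exists (repr u); rewrite -[u in LHS]module_class_repr.
by rewrite -[repr u in LHS]mulr1 module_classM.
Qed.

End CyclicModule.

Section Words.
Variables (F : fieldType) (T : choiceType).

Definition word_algebra := {malg F[{fmonom T}]}.
HB.instance Definition _ := GRing.Lalgebra.on word_algebra.

Fact word_algebra_scaleAr (c : F) (x y : word_algebra) :
  c *: (x * y) = x * (c *: y).
Proof.
have cC (z : word_algebra) : c *: z = z * c%:MP.
  rewrite malgM_def fgmulgU malgZ_def /fgscale.
  by apply: eq_bigr => k _; rewrite mulm1 mulrC.
by rewrite !cC mulrA.
Qed.
HB.instance Definition _ := GRing.Lalgebra_isAlgebra.Build F word_algebra
  word_algebra_scaleAr.

Definition word_letter (x : T) : word_algebra := << fmu x >>.

End Words.

(* The free F-algebra on T with its generators. It is locked because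
   unification diverges when it may unfold the product of {malg F[_]}. *)
HB.lock Definition free_algebra_letter (F : fieldType) (T : choiceType) :
    {A : algType F & T -> A} :=
  existT (fun A : algType F => T -> A) (word_algebra F T) (@word_letter F T).

Definition free_algebra (F : fieldType) (T : choiceType) : algType F :=
  projT1 (free_algebra_letter F T).
Definition letter (F : fieldType) (T : choiceType) (x : T) :
  free_algebra F T := projT2 (free_algebra_letter F T) x.

(* a_r, positions being counted from 1 *)
Definition entry (a : seq nat) (r : nat) : nat := nth 0%N a r.-1.

Section KLR.
Variables (F : fieldType) (e n : nat).

(* I = 'Z_e, which is Z/eZ as soon as 1 < e. *)
Definition Iseq := n.-tuple 'Z_e.

(* All positions are counted from 1: res i r is the entry i_r, for
   1 <= r <= n. *)
Definition res (i : Iseq) (r : nat) : 'Z_e := nth 0 i r.-1.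

Definition swap_res (r : nat) (i : Iseq) : Iseq :=
  [tuple res i ([fun k => k with r |-> r.+1, r.+1 |-> r] k.+1) | k < n].

Definition klr_letter := (Iseq + 'I_n + 'I_n.-1)%type.
Local Notation klr_free := (free_algebra F klr_letter).

(* free_y r and free_psi r are the letters with ordinals r - 1; only
   1 <= r <= n, respectively 1 <= r <= n - 1, is meaningful. *)
Definition free_e (i : Iseq) : klr_free := letter F (inl (inl i)).
Definition free_y (r : nat) : klr_free :=
  if insub r.-1 is Some k then letter F (inl (inr k)) else 0.
Definition free_psi (r : nat) : klr_free :=
  if insub r.-1 is Some k then letter F (inr k) else 0.

Local Notation e_ := free_e.
Local Notation y := free_y.
Local Notation psi := free_psi.

Definition arrow (a b : 'Z_e) : bool := b == a + 1.

Inductive klr_rel : klr_free -> klr_free -> Prop :=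
| klr_ee i j : klr_rel (e_ i * e_ j) (if i == j then e_ i else 0)
| klr_e1 : klr_rel (\sum_(i : Iseq) e_ i) 1
| klr_ye r i of (1 <= r <= n)%N : klr_rel (y r * e_ i) (e_ i * y r)
| klr_psie r i of (1 <= r < n)%N :
    klr_rel (psi r * e_ i) (e_ (swap_res r i) * psi r)
| klr_yy r s of (1 <= r <= n)%N & (1 <= s <= n)%N :
    klr_rel (y r * y s) (y s * y r)
| klr_psiy r s of (1 <= r < n)%N & (1 <= s <= n)%N & s != r & s != r.+1 :
    klr_rel (psi r * y s) (y s * psi r)
| klr_psipsi r s of (1 <= r < n)%N & (1 <= s < n)%N &
    ((r.+1 < s) || (s.+1 < r))%N :
    klr_rel (psi r * psi s) (psi s * psi r)
| klr_psiyS r i of (1 <= r < n)%N :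
    klr_rel (psi r * y r.+1 * e_ i)
            ((y r * psi r + (res i r == res i r.+1)%:R) * e_ i)
| klr_ySpsi r i of (1 <= r < n)%N :
    klr_rel (y r.+1 * psi r * e_ i)
            ((psi r * y r + (res i r == res i r.+1)%:R) * e_ i)
| klr_psi2 r i of (1 <= r < n)%N :
    klr_rel (psi r ^+ 2 * e_ i)
      (if res i r == res i r.+1 then 0
       else if arrow (res i r) (res i r.+1) then (y r.+1 - y r) * e_ i
       else if arrow (res i r.+1) (res i r) then (y r - y r.+1) * e_ i
       else e_ i)
| klr_braid r i of (1 <= r)%N & (r.+1 < n)%N :
    klr_rel (psi r * psi r.+1 * psi r * e_ i)
      (if (res i r.+2 == res i r) && arrow (res i r) (res i r.+1) then
         (psi r.+1 * psi r * psi r.+1 + 1) * e_ i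
       else if (res i r.+2 == res i r) && arrow (res i r.+1) (res i r) then
         (psi r.+1 * psi r * psi r.+1 - 1) * e_ i
       else psi r.+1 * psi r * psi r.+1 * e_ i).

Definition klr := quotient_ring klr_rel.
HB.instance Definition _ := GRing.PzRing.on klr.
HB.instance Definition _ := GRing.Lmodule.on klr.

Definition klr_class (x : klr_free) : klr := ring_class klr_rel x.

Definition klr_e (i : Iseq) : klr := klr_class (free_e i).
Definition klr_y (r : nat) : klr := klr_class (free_y r).
Definition klr_psi (r : nat) : klr := klr_class (free_psi r).

Section Specht.
Variables (kappa1 kappa2 : 'Z_e) (m : nat).

Definition hook_res : Iseq :=
  [tuple if (k < m)%N then kappa2 - k%:R else kappa1 + (k - m)%:R | k < n].

Inductive specht_rel : klr -> klr -> Prop :=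
| specht_e : specht_rel (klr_e hook_res) 1
| specht_y r of (1 <= r <= n)%N : specht_rel (klr_y r) 0
| specht_psi r of (1 <= r < n)%N & r != m : specht_rel (klr_psi r) 0.

Definition specht := cyclic_module specht_rel.
HB.instance Definition _ := GRing.Lmodule.on specht.

Definition specht_z : specht := cyclic_gen specht_rel.

(* v [:: a_1; ...; a_m]; big products over a sequence multiply from left to
   right, so the inner one is psi_(a_j - 1) ... psi_j. *)
Definition specht_v (a : seq nat) : specht :=
  (\prod_(1 <= j < (size a).+1)
     \prod_(k <- rev (index_iota j (entry a j))) klr_psi k) *: specht_z.

End Specht.
End KLR.

Section ActionCases.
Variables (e n : nat) (kappa1 kappa2 : 'Z_e) (l : nat) (a : seq nat).

Local Open Scope nat_scope.

Definition case_i (r : nat) : Prop :=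
  [/\ 1 <= r <= size a, entry a r = l & r = size a \/ l + 2 <= entry a r.+1].

Definition case_ii_pair (r : nat) : Prop :=
  [/\ l%:R = (kappa2 - kappa1)%R, l < n - 1, 1 <= r <= size a - 1,
      entry a r = l + 1 /\ entry a r.+1 = l + 2 &
      r = 1 \/ entry a r.-1 <= l - 1].

Definition case_ii_single (r : nat) : Prop :=
  [/\ l%:R = (kappa2 - kappa1)%R, l < n - 1, 1 <= r <= size a,
      entry a r = l + 2 & r = 1 \/ entry a r.-1 <= l - 1].

(* The leg of the resulting tableau contains l - 1, so both parts of (iii)
   presuppose 2 <= l, just as (ii) presupposes l + 2 <= n. *)
Definition case_iii_pair (r : nat) : Prop :=
  [/\ l%:R = (2%:R + kappa2 - kappa1)%R, 2 <= l, 1 <= r <= size a - 1,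
      entry a r = l /\ entry a r.+1 = l + 1 &
      r = 1 \/ entry a r.-1 <= l - 2].

Definition case_iii_single (r : nat) : Prop :=
  [/\ l%:R = (2%:R + kappa2 - kappa1)%R, 2 <= l, 1 <= r <= size a,
      entry a r = l + 1 & r = 1 \/ entry a r.-1 <= l - 2].

Definition case_iv (r : nat) : Prop :=
  [/\ (l%:R + kappa1 - kappa2)%R \notin [:: 0; 1; 2%:R]%R, 1 <= r <= size a,
      entry a r = l + 1 & r = 1 \/ entry a r.-1 <= l - 1].

(* (a_1, ..., a_(r-1)) ++ b ++ (the entries of a from position r + size b on) *)
Definition replace_at (r : nat) (b : seq nat) : seq nat :=
  take r.-1 a ++ b ++ drop (r.-1 + size b) a.

End ActionCases.

(* Main.v *)
(* A standard tableau is a word in A (arm) and L (leg), and psi_k v(..LA..) =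
   v(..AL..) when LA is at positions k, k+1. Hence any word w other than the
   initial one L^m A^(n-m) has v(w) = psi_k v(w') with w' smaller. The action of
   the psi_l is computed by induction on w together with that of the y_r: y_r
   kills v(w) unless AL occurs at positions k, k+1 with equal residues
   (k + kappa1 - kappa2 = 1) and r is k or k+1, in which case the
   result is -v(w') or v(w'), where w' is w with AL replaced by LA. On AL the
   quadratic relation applies, and these values of y_l and y_(l+1) account for
   the special cases; on ALL and AAL the braid relation applies, and its
   correction term is the only one to survive; in the other words with AA or LL
   at l, psi_l commutes past some psi_k and the induction gives zero. *)

Require Import Defs.
From mathcomp Require Import all_boot all_algebra.
From mathcomp Require Import boolp zify ring.

Set Implicit Arguments.
Unset Strict Implicit.
Unset Printing Implicit Defensive.

Import GRing.Theory.
Local Open Scope ring_scope.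

(** The computation runs over any ring with elements satisfying these relations, independently of
    how [klr] is built as a quotient. *)
Record klr_family (e n : nat) (A : pzRingType)
    (E : Iseq e n -> A) (y psi : nat -> A) : Prop := KlrFamily {
  klr_family_psie : forall r i, (1 <= r < n)%N ->
    psi r * E i = E (swap_res r i) * psi r;
  klr_family_psiy : forall r s, (1 <= r < n)%N -> (1 <= s <= n)%N ->
    s != r -> s != r.+1 -> psi r * y s = y s * psi r;
  klr_family_psipsi : forall r s, (1 <= r < n)%N -> (1 <= s < n)%N ->
    (r.+1 < s)%N || (s.+1 < r)%N -> psi r * psi s = psi s * psi r;
  klr_family_psiyS : forall r i, (1 <= r < n)%N ->
    psi r * y r.+1 * E i = (y r * psi r + (res i r == res i r.+1)%:R) * E i;
  klr_family_ySpsi : forall r i, (1 <= r < n)%N ->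
    y r.+1 * psi r * E i = (psi r * y r + (res i r == res i r.+1)%:R) * E i;
  klr_family_psi2 : forall r i, (1 <= r < n)%N ->
    psi r ^+ 2 * E i =
      if res i r == res i r.+1 then 0
      else if arrow (res i r) (res i r.+1) then (y r.+1 - y r) * E i
      else if arrow (res i r.+1) (res i r) then (y r - y r.+1) * E i
      else E i;
  klr_family_braid : forall r i, (1 <= r)%N -> (r.+1 < n)%N ->
    psi r * psi r.+1 * psi r * E i =
      if (res i r.+2 == res i r) && arrow (res i r) (res i r.+1) then
        (psi r.+1 * psi r * psi r.+1 + 1) * E i
      else if (res i r.+2 == res i r) && arrow (res i r.+1) (res i r) then
        (psi r.+1 * psi r * psi r.+1 - 1) * E i
      else psi r.+1 * psi r * psi r.+1 * E i }.

(** * The relations as identities between vectors of a module *)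

Section ActionOfRelations.
Variables (e n : nat) (A : pzRingType) (E : Iseq e n -> A) (y psi : nat -> A).
Hypothesis klrP : klr_family E y psi.
Variable M : lmodType A.
Implicit Type u : M.

Let actM a b u : (a * b) *: u = a *: (b *: u).
Proof. by rewrite scalerA. Qed.

Lemma psi_commA r s u : (1 <= r < n)%N -> (1 <= s < n)%N ->
  (r.+1 < s)%N || (s.+1 < r)%N -> psi r *: (psi s *: u) = psi s *: (psi r *: u).
Proof. by move=> rP sP rs; rewrite !scalerA (klr_family_psipsi klrP). Qed.

Lemma psi_y_commA r s u : (1 <= r < n)%N -> (1 <= s <= n)%N ->
  s != r -> s != r.+1 -> y s *: (psi r *: u) = psi r *: (y s *: u).
Proof. by move=> *; rewrite !scalerA (klr_family_psiy klrP). Qed.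

(** On a vector of residue sequence [i] the relation is solved for [y] standing left of [psi], so
    that [y] can be moved onto the vector. *)
Lemma y_psiA r i u : (1 <= r < n)%N -> E i *: u = u ->
  y r *: (psi r *: u) =
    psi r *: (y r.+1 *: u) - u *+ (res i r == res i r.+1).
Proof.
move=> rP iu; have := klr_family_psiyS klrP i rP.
move/(congr1 (fun x => x *: u)); rewrite !actM iu scalerDl !actM => ->.
by rewrite scaler_nat addrK.
Qed.

Lemma yS_psiA r i u : (1 <= r < n)%N -> E i *: u = u ->
  y r.+1 *: (psi r *: u) =
    psi r *: (y r *: u) + u *+ (res i r == res i r.+1).
Proof.
move=> rP iu; have := klr_family_ySpsi klrP i rP.
move/(congr1 (fun x => x *: u)); rewrite !actM iu scalerDl !actM => ->.
by rewrite scaler_nat.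
Qed.

Lemma psi2A r i u : (1 <= r < n)%N -> E i *: u = u ->
  psi r *: (psi r *: u) =
    if res i r == res i r.+1 then 0
    else if arrow (res i r) (res i r.+1) then y r.+1 *: u - y r *: u
    else if arrow (res i r.+1) (res i r) then y r *: u - y r.+1 *: u
    else u.
Proof.
move=> rP iu; have := klr_family_psi2 klrP i rP.
move/(congr1 (fun x => x *: u)); rewrite expr2 !actM iu => ->.
case: eqP => _; first by rewrite scale0r.
case: ifP => _; last case: ifP => _; by rewrite ?actM iu // scalerBl.
Qed.

Lemma braidA r i u : (1 <= r)%N -> (r.+1 < n)%N -> E i *: u = u ->
  psi r *: (psi r.+1 *: (psi r *: u)) =
    psi r.+1 *: (psi r *: (psi r.+1 *: u)) +
    if res i r.+2 == res i r then
      if arrow (res i r) (res i r.+1) then u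
      else if arrow (res i r.+1) (res i r) then - u else 0
    else 0.
Proof.
move=> r1 rn iu; have := klr_family_braid klrP i r1 rn.
move/(congr1 (fun x => x *: u)); rewrite !actM iu => ->.
case: eqP => _ /=; last by rewrite !actM iu addr0.
case: ifP => _; first by rewrite !actM iu scalerDl !actM scale1r.
case: ifP => _; first by rewrite !actM iu scalerBl !actM scale1r.
by rewrite !actM iu addr0.
Qed.

End ActionOfRelations.

(** * The quotient algebra satisfies the relations *)

Section KlrIsFamily.
Variables (F : fieldType) (e n : nat).
Local Notation cl := (@klr_class F e n).

Lemma klr_class_rel x z : @klr_rel F e n x z -> cl x = cl z.
Proof. exact: ring_class_rel. Qed.
Lemma klr_classM x z : cl (x * z) = cl x * cl z.
Proof. exact: rmorphM. Qed.
Lemma klr_classD x z : cl (x + z) = cl x + cl z.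
Proof. exact: rmorphD. Qed.
Lemma klr_classB x z : cl (x - z) = cl x - cl z.
Proof. exact: rmorphB. Qed.
Lemma klr_classX x k : cl (x ^+ k) = cl x ^+ k.
Proof. exact: rmorphXn. Qed.
Lemma klr_class0 : cl 0 = 0.
Proof. exact: rmorph0. Qed.
Lemma klr_class1 : cl 1 = 1.
Proof. exact: rmorph1. Qed.
Lemma klr_class_nat k : cl k%:R = k%:R.
Proof. exact: rmorph_nat. Qed.

Lemma klr_is_family :
  klr_family (@klr_e F e n) (klr_y F e n) (klr_psi F e n).
Proof.
split; rewrite /klr_e /klr_y /klr_psi.
- by move=> r i rP; rewrite -!klr_classM; apply/klr_class_rel/klr_psie.
- by move=> *; rewrite -!klr_classM; apply/klr_class_rel/klr_psiy.
- by move=> *; rewrite -!klr_classM; apply/klr_class_rel/klr_psipsi.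
- move=> r i rP; rewrite -!klr_classM -klr_class_nat -klr_classD -klr_classM.
  exact/klr_class_rel/klr_psiyS.
- move=> r i rP; rewrite -!klr_classM -klr_class_nat -klr_classD -klr_classM.
  exact/klr_class_rel/klr_ySpsi.
- move=> r i rP; rewrite -!klr_classB -klr_classX -!klr_classM.
  rewrite -klr_class0 -!(fun_if (@klr_class F e n)).
  exact/klr_class_rel/klr_psi2.
- move=> r i r1 rn; rewrite -!klr_classM -klr_class1 -klr_classB.
  rewrite -klr_classD -!klr_classM -!(fun_if (@klr_class F e n)).
  exact/klr_class_rel/klr_braid.
Qed.
End KlrIsFamily.

(** * Words *)

Section Words.
Local Open Scope nat_scope.
Implicit Type w : nat -> bool.

(* A word w records a tableau: w p holds when p is an entry of the leg. *)
Definition swap (k : nat) w : nat -> bool := fun p =>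
  if p == k then w k.+1 else if p == k.+1 then w k else w p.

Lemma swap_l k w : swap k w k = w k.+1.
Proof. by rewrite /swap eqxx. Qed.
Lemma swap_r k w : swap k w k.+1 = w k.
Proof. by rewrite /swap eqxx; case: eqP => //; lia. Qed.
Lemma swap_out k w p : p != k -> p != k.+1 -> swap k w p = w p.
Proof. by rewrite /swap => /negbTE-> /negbTE->. Qed.

Lemma swapK k w : swap k (swap k w) = w.
Proof.
apply/funext => p; rewrite /swap eqxx.
by repeat case: eqP => ?; subst => //; lia.
Qed.

Lemma swapC j k w : (j.+1 < k) || (k.+1 < j) ->
  swap j (swap k w) = swap k (swap j w).
Proof.
move=> jk; apply/funext => p; rewrite /swap.
by repeat case: eqP => ?; subst => //; lia.
Qed.

Definition legs (n : nat) w : seq nat := filter w (iota 1 n).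

(* The convention w 0 = true, w p = false for p > n makes the boundary
   conditions 2 <= l of (iii) and l < n - 1 of (ii) automatic. *)
Record hook_word (n m : nat) w : Prop := HookWord {
  hook_word0 : w 0;
  hook_word_out : forall p, n < p -> w p = false;
  hook_word_size : size (legs n w) = m }.

Definition leg_count w (k : nat) : nat := count w (iota 1 k).

Lemma leg_countS w k : leg_count w k.+1 = leg_count w k + w k.+1.
Proof.
by rewrite /leg_count -[in LHS](addn1 k) iotaD count_cat /= addn0 add1n.
Qed.

Lemma leg_count_le w k : leg_count w k <= k.
Proof. by rewrite -[leqRHS](size_iota 1 k) count_size. Qed.

(** Exchanging the letters at [k] and [k.+1] changes a prefix count only if the prefix ends between
    them. *)
Lemma leg_count_swap w k p : p != k -> 0 < k ->
  leg_count (swap k w) p = leg_count w p.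
Proof.
move=> pk k0; have below q : q < k -> leg_count (swap k w) q = leg_count w q.
  move=> qk; apply: eq_in_count => i; rewrite mem_iota => /andP[_ iq].
  by rewrite swap_out //; lia.
have [|kp] := ltnP p k; first exact: below.
(* Beyond [k] the prefix contains both exchanged letters; the induction runs on its length past
   [k.+1]. *)
have -> : p = k.-1 + (p - k.+1).+2 by lia.
elim: (p - k.+1) => [|q IH]; last first.
  by rewrite addnS leg_countS IH (leg_countS w) swap_out //; lia.
rewrite !addnS addn0 prednK // !leg_countS.
case: k k0 {pk kp} below => // k _ below /=.
rewrite !leg_countS swap_l swap_r below //; lia.
Qed.

Lemma legs_sorted n w : sorted ltn (legs n w).
Proof. exact/(sorted_filter ltn_trans)/iota_ltn_sorted. Qed.

Lemma mem_legs n w p : (p \in legs n w) = w p && (1 <= p <= n).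
Proof. by rewrite mem_filter mem_iota add1n ltnS. Qed.

Lemma legs_split n k w : 1 <= k < n ->
  legs n w = filter w (iota 1 k.-1) ++
    ([seq p <- [:: k; k.+1] | w p] ++ filter w (iota k.+2 (n - k.+1))).
Proof.
move=> kn; have -> : n = k.-1 + (2 + (n - k.+1)) by lia.
rewrite /legs iotaD filter_cat; congr (_ ++ _).
rewrite iotaD filter_cat; have -> : 1 + k.-1 = k by lia.
by rewrite addn2; congr (_ ++ filter _ (iota _ _)); lia.
Qed.

(** An [L] moved from [k] to [k.+1] keeps its rank in the leg. The bound on [size x] holds because
    the earlier entries are distinct positive numbers below [k]; it lets [psi k] extend the factor
    of this entry. *)
Lemma legs_swap n k w : 1 <= k < n -> w k -> ~~ w k.+1 ->
  exists x z, [/\ legs n w = x ++ k :: z, legs n (swap k w) = x ++ k.+1 :: z,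
    size x < k & all (fun p => 1 <= p < k) x].
Proof.
move=> kn wk /negbTE wk1.
exists (filter w (iota 1 k.-1)), (filter w (iota k.+2 (n - k.+1))).
split.
- by rewrite (legs_split _ kn) /= wk wk1.
- rewrite (legs_split _ kn) /= swap_l swap_r wk wk1 /=; congr (_ ++ _ :: _);
    apply: eq_in_filter => p; rewrite mem_iota => pP;
    by rewrite swap_out //; lia.
- have := count_size w (iota 1 k.-1); rewrite size_filter size_iota; lia.
- by apply/allP => p; rewrite mem_filter mem_iota => /andP[_]; lia.
Qed.

Lemma hook_word_swap n m k w : 1 <= k < n -> hook_word n m w ->
  hook_word n m (swap k w).
Proof.
move=> kn [w0 wout wsz]; split.
- by rewrite swap_out //; lia.
- by move=> p np; rewrite swap_out ?wout //; lia.
- rewrite -wsz /legs !size_filter -!/(leg_count _ n).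
  by rewrite leg_count_swap //; lia.
Qed.

(** The sum of the leg entries drops by one when [AL] becomes [LA]; it is the measure for the
    inductions on words. *)
Lemma legs_swap_sumn n k w : 1 <= k < n -> ~~ w k -> w k.+1 ->
  sumn (legs n (swap k w)) < sumn (legs n w).
Proof.
move=> kn wk wk1; have := @legs_swap n k (swap k w) kn.
rewrite swap_l swap_r swapK => /(_ wk1 wk)[x [z [-> -> _ _]]].
by rewrite !sumn_cat /=; lia.
Qed.

(** In a word closed downwards, everything after the first [A] is [A]. *)
Lemma filter_iota_antitone w s k : (forall p, w p.+1 -> w p) ->
  filter w (iota s k) = iota s (count w (iota s k)).
Proof.
move=> anti; elim: k s => [//|k IH] s /=.
case ws: (w s); first by rewrite IH.
have out p : s <= p -> w p = false.
  by move/subnKC <-; elim: (p - s) => [|q IHq]; rewrite ?addn0 ?addnS //;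
     apply/negP => /anti; rewrite IHq.
have: [seq p <- iota s.+1 k | w p] = [::].
  rewrite -(filter_pred0 (iota s.+1 k)); apply: eq_in_filter => p.
  by rewrite mem_iota => /andP[/ltnW/out ->].
by move=> f0; rewrite f0 -size_filter f0.
Qed.

(** A word without [AL] is closed downwards, so all its [L] come first. The conventions at 0 and
    beyond [n] exclude an [AL] across the boundary. *)
Lemma hook_word_initial_or n m w : hook_word n m w ->
  w = (fun p => p <= m) \/
  exists k, [/\ 1 <= k < n, ~~ w k & w k.+1].
Proof.
move=> [w0 wout wsz].
have [[k [kP wk wk1]]|none] :=
  pselect (exists k, [/\ 1 <= k < n, ~~ w k & w k.+1]).
  by right; exists k.
left; have anti p : w p.+1 -> w p.
  move=> wp; apply/negPn/negP => nwp; apply: none; exists p; split=> //.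
  have := wout p.+1; case: p {nwp} wp (nwp) => [|p] wp nwp.
    by rewrite w0 in nwp.
  by rewrite wp; case: (ltnP p.+1 n) => // ? /(_ _); lia.
apply/funext => p; have := mem_legs n w p.
rewrite /legs filter_iota_antitone // -size_filter -/(legs n w) wsz mem_iota.
have mn : m <= n.
  by rewrite -wsz size_filter -[leqRHS](size_iota 1 n) count_size.
case: (posnP p) => [-> //|p0]; case: (leqP p n) => pn.
  by rewrite andbT; lia.
by rewrite wout; lia.
Qed.

Lemma leg_count_initial m k : leg_count (fun p => p <= m) k = minn k m.
Proof.
elim: k => [|k IH]; first by rewrite min0n.
by rewrite leg_countS IH; case: (leqP k.+1 m) => /=; lia.
Qed.

Lemma legs_initial n m : m <= n -> legs n (fun p => p <= m) = iota 1 m.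
Proof.
move=> mn; rewrite /legs filter_iota_antitone => [|p]; last exact: ltnW.
by rewrite -/(leg_count _ n) leg_count_initial (minn_idPr mn).
Qed.
End Words.

(** * Increasing sequences and the words they define *)

Section Entries.
Local Open Scope nat_scope.
Implicit Type a : seq nat.

Lemma entry_ltn a i j : sorted ltn a -> 1 <= i <= size a -> 1 <= j <= size a ->
  (entry a i < entry a j) = (i < j).
Proof.
move=> sa iP jP; rewrite /entry.
have mono := sorted_ltn_nth ltn_trans 0 sa.
have [ij|ji] := ltnP i j.
  by apply: mono; rewrite ?inE; lia.
apply/negbTE; rewrite -leqNgt; have [->//|ne] := eqVneq i j.
by apply/ltnW/mono; rewrite ?inE; lia.
Qed.

Lemma entry_mem a r : 1 <= r <= size a -> entry a r \in a.
Proof.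
move=> rP; have lt_r : r.-1 < size a by lia.
exact: mem_nth.
Qed.

Lemma mem_entry a p : p \in a -> exists2 r, 1 <= r <= size a & entry a r = p.
Proof.
move=> pa; exists (index p a).+1; first by rewrite index_mem.
exact: nth_index.
Qed.

(** An entry [p] in the gap would have an index below [r], hence at most [r.-1], and so a value at
    most [b]. *)
Lemma gap_below a r b p : sorted ltn a -> 1 <= r <= size a ->
  r = 1 \/ entry a r.-1 <= b -> b < p < entry a r -> p \notin a.
Proof.
move=> sa rP rb bp; apply/negP => /mem_entry[s sP sp].
have := entry_ltn sa sP rP; have [?|r1] := eqVneq r 1; first by lia.
case: rb => [/eqP|rb]; first by rewrite (negbTE r1).
have rP' : 1 <= r.-1 <= size a by lia.
have := entry_ltn sa rP' sP; lia.
Qed.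

Lemma gap_above a r c p : sorted ltn a -> 1 <= r <= size a ->
  r = size a \/ c <= entry a r.+1 -> entry a r < p < c -> p \notin a.
Proof.
move=> sa rP rc cp; apply/negP => /mem_entry[s sP sp].
have := entry_ltn sa rP sP; have [?|rs] := eqVneq r (size a); first by lia.
case: rc => [/eqP|rc]; first by rewrite (negbTE rs).
have rP' : 1 <= r.+1 <= size a by lia.
have := entry_ltn sa sP rP'; lia.
Qed.

Lemma entry_prev a r : sorted ltn a -> 1 <= r <= size a ->
  r = 1 \/ entry a r.-1 < entry a r /\ entry a r.-1 \in a.
Proof.
move=> sa rP; have [->|r1] := eqVneq r 1; [by left|right].
by rewrite entry_ltn ?entry_mem //; lia.
Qed.

Lemma entry_next a r : sorted ltn a -> 1 <= r <= size a ->
  r = size a \/ entry a r < entry a r.+1 /\ entry a r.+1 \in a.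
Proof.
move=> sa rP; have [->|r1] := eqVneq r (size a); [by left|right].
by rewrite entry_ltn ?entry_mem //; lia.
Qed.

Lemma entry_succ a r c : sorted ltn a -> 1 <= r <= size a ->
  entry a r = c -> c.+1 \in a -> r < size a /\ entry a r.+1 = c.+1.
Proof.
move=> sa rP rc /mem_entry[s sP sc].
have := entry_ltn sa rP sP; rewrite rc sc ltnSn => /esym rs.
have rP' : 1 <= r.+1 <= size a by lia.
have := entry_ltn sa rP' sP; have := entry_ltn sa rP rP'.
rewrite rc sc; have [sr|] := eqVneq s r.+1; last by lia.
by subst s; split => //; lia.
Qed.

(** Distinct entries have one index each, so the index of [c] can be read off from the splitting. *)
Lemma entry_cat x c z r : uniq (x ++ c :: z) -> 1 <= r <= size (x ++ c :: z) ->
  entry (x ++ c :: z) r = c -> r.-1 = size x.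
Proof.
move=> ua rP rc; apply/eqP; rewrite -(nth_uniq 0 _ _ ua); try by lia.
  by rewrite -/(entry _ r) rc nth_cat ltnn subnn.
by rewrite size_cat /=; lia.
Qed.

Lemma replace_at1 a x c z r b : a = x ++ c :: z -> uniq a ->
  1 <= r <= size a -> entry a r = c -> replace_at a r [:: b] = x ++ b :: z.
Proof.
move=> -> ua rP /(entry_cat ua rP) rx; rewrite /replace_at rx take_size_cat //=.
by rewrite drop_cat ifN; [rewrite addKn /= drop0 | lia].
Qed.

Lemma replace_at2 a x c d z r b f : a = x ++ c :: d :: z -> uniq a ->
  1 <= r <= size a -> entry a r = c ->
  replace_at a r [:: b; f] = x ++ b :: f :: z.
Proof.
move=> -> ua rP /(entry_cat ua rP) rx; rewrite /replace_at rx take_size_cat //=.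
by rewrite drop_cat ifN; [rewrite addKn /= drop0 | lia].
Qed.

(** Position 0 counts as [L], the convention of [hook_word]. *)
Definition leg_word (a : seq nat) : nat -> bool :=
  fun p => (p == 0) || (p \in a).

Lemma legs_leg_word n a : sorted ltn a -> all (fun x => 1 <= x <= n) a ->
  legs n (leg_word a) = a.
Proof.
move=> sa /allP ra; apply: (irr_sorted_eq ltn_trans ltnn) => //.
  exact: legs_sorted.
move=> p; rewrite mem_legs /leg_word; case pa : (p \in a).
  by rewrite orbT /= (ra p pa).
by rewrite orbF; case: p {pa}.
Qed.

Lemma hook_leg_word n a : sorted ltn a -> all (fun x => 1 <= x <= n) a ->
  hook_word n (size a) (leg_word a).
Proof.
move=> sa ra; split=> // [p np|]; last by rewrite legs_leg_word.
rewrite /leg_word; have -> /= : (p == 0) = false by lia.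
by apply/negP => /(allP ra); lia.
Qed.

(** This locates a replacement in a leg: words that agree outside the [d] positions from [k] on have
    legs with the same beginning and the same end. *)
Lemma legs_window n k d (w w' : nat -> bool) : 0 < k -> k + d <= n.+1 ->
  (forall p, (p < k) || (k + d <= p) -> w' p = w p) ->
  exists x z, legs n w = x ++ (filter w (iota k d) ++ z) /\
              legs n w' = x ++ (filter w' (iota k d) ++ z).
Proof.
move=> k0 kn ww'; exists (filter w (iota 1 k.-1)).
exists (filter w (iota (k + d) (n.+1 - (k + d)))).
have split v : legs n v = filter v (iota 1 k.-1) ++
    (filter v (iota k d) ++ filter v (iota (k + d) (n.+1 - (k + d)))).
  rewrite -!filter_cat -iotaD -{2}(prednK k0) -add1n.
  by rewrite -iotaD /legs; congr (filter _ (iota _ _)); lia.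
rewrite !split; split=> //; congr (_ ++ (_ ++ _));
  by apply: eq_in_filter => p; rewrite mem_iota => pP; apply: ww'; lia.
Qed.
End Entries.

(** * The action on the standard basis *)

Definition leg_factor (A : pzRingType) (psi : nat -> A) (j c : nat) : A :=
  \prod_(k <- rev (index_iota j c)) psi k.

(** The product in [specht_v] in recursive form. The running [j] is the index at which the factor of
    the head entry ends, so that inductions can peel off entries. *)
Fixpoint leg_product (A : pzRingType) (psi : nat -> A) (j : nat) (a : seq nat) :
    A :=
  if a is c :: a' then leg_factor psi j c * leg_product psi j.+1 a' else 1.

Section LegProduct.
Variables (A : pzRingType) (psi : nat -> A).

Lemma leg_productE j a :
  leg_product psi j a =
    \prod_(j <= i < j + size a) leg_factor psi i (nth 0%N a (i - j)).
Proof.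
elim: a j => [|c a IH] j /=; first by rewrite addn0 big_geq.
rewrite big_ltn ?addnS ?ltnS ?leq_addr // subnn; congr (_ * _).
rewrite IH addSn; apply: eq_big_nat => i /andP[ji _].
by rewrite -[(i - j)%N]/((i.+1 - j.+1)%N) subSn.
Qed.

Lemma leg_factorS j c : (j <= c)%N ->
  leg_factor psi j c.+1 = psi c * leg_factor psi j c.
Proof.
move=> jc; rewrite /leg_factor /index_iota subSn // -addn1 iotaD rev_cat /=.
by rewrite big_cons subnKC.
Qed.

Lemma leg_factor_nil j c : (c <= j)%N -> leg_factor psi j c = 1.
Proof. by move=> cj; rewrite /leg_factor /index_iota (eqP cj) big_nil. Qed.

Variable n : nat.
Hypothesis psi_comm : forall r s, (1 <= r < n)%N -> (1 <= s < n)%N ->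
  (r.+1 < s)%N || (s.+1 < r)%N -> psi r * psi s = psi s * psi r.

(** Each index [i] in the factor satisfies [i < c < k], so [psi i] commutes with [psi k]. *)
Lemma psi_leg_factor k j c : (1 <= k < n)%N -> (1 <= j)%N -> (c < k)%N ->
  psi k * leg_factor psi j c = leg_factor psi j c * psi k.
Proof.
move=> kn j1 ck; rewrite /leg_factor.
have: all (fun i => 1 <= i < c)%N (rev (index_iota j c)).
  by apply/allP => i; rewrite mem_rev mem_index_iota; lia.
elim: (rev _) => [|i s IH] /=; first by rewrite big_nil mulr1 mul1r.
case/andP=> ic /IH; rewrite big_cons -mulrA => <-.
by rewrite !mulrA psi_comm //; lia.
Qed.

(** [psi k] slides past the factors of the entries below [k] and then lengthens the factor of [k] to
    that of [k.+1]; by the size bound this factor ends at an index at most [k]. *)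
Lemma psi_leg_product k j x a : (1 <= k < n)%N -> (1 <= j)%N ->
    all (fun c => c < k)%N x -> (j + size x <= k)%N ->
  psi k * leg_product psi j (x ++ k :: a) = leg_product psi j (x ++ k.+1 :: a).
Proof.
move=> kn; elim: x j => [|c x IH] j j1 /=.
  by move=> _; rewrite addn0 => jk; rewrite leg_factorS // mulrA.
case/andP=> ck xk jk; rewrite mulrA psi_leg_factor // -mulrA IH //.
by rewrite addSnnS.
Qed.

Lemma leg_product_initial j k : leg_product psi j (iota j k) = 1.
Proof. by elim: k j => [//|k IH] j /=; rewrite IH leg_factor_nil ?mulr1. Qed.

End LegProduct.

(** * Standard vectors over a generator satisfying the Specht relations *)

Section HookModule.
Variables (e n : nat) (A : pzRingType) (E : Iseq e n -> A) (y psi : nat -> A).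
Variables (M : lmodType A) (z : M) (kappa1 kappa2 : 'Z_e) (m : nat).
Hypothesis klrP : klr_family E y psi.
Hypothesis z_e : E (hook_res n kappa1 kappa2 m) *: z = z.
Hypothesis z_y : forall r, (1 <= r <= n)%N -> y r *: z = 0.
Hypothesis z_psi : forall r, (1 <= r < n)%N -> r != m -> psi r *: z = 0.
Hypothesis e3 : (3 <= e)%N.
Implicit Type w : nat -> bool.

Definition vec w : M := leg_product psi 1 (legs n w) *: z.

Lemma psi_vec k w : (1 <= k < n)%N -> w k -> ~~ w k.+1 ->
  psi k *: vec w = vec (swap k w).
Proof.
move=> kn wk wk1; have [x [a [lw lE xk xlt]]] := legs_swap kn wk wk1.
rewrite /vec lw lE scalerA (@psi_leg_product _ _ n) //.
  exact: klr_family_psipsi klrP.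
by apply: sub_all xlt => p /andP[].
Qed.

Lemma vec_pred k w : (1 <= k < n)%N -> ~~ w k -> w k.+1 ->
  vec w = psi k *: vec (swap k w).
Proof. by move=> *; rewrite psi_vec ?swapK ?swap_l ?swap_r. Qed.

Lemma hook_word_le w : hook_word n m w -> (m <= n)%N.
Proof.
by case=> _ _ <-; rewrite size_filter -[leqRHS](size_iota 1 n) count_size.
Qed.

Lemma vec_initial : (m <= n)%N -> vec (fun p => p <= m)%N = z.
Proof.
by move=> mn; rewrite /vec legs_initial // leg_product_initial scale1r.
Qed.

(** The residues of the nodes in the order in which the tableau fills them: they decrease from
    [kappa2] down the leg and increase from [kappa1] along the arm. *)
Definition word_res w : Iseq e n :=
  [tuple if w k.+1 then kappa2 - (leg_count w k)%:R
         else kappa1 + (k - leg_count w k)%:R | k < n].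

Lemma res_tuple (f : nat -> 'Z_e) k : (k < n)%N ->
  res [tuple f k | k < n] k.+1 = f k.
Proof.
move=> kn; rewrite /res /= (nth_map (Ordinal kn)) ?size_enum_ord //.
by rewrite nth_enum_ord.
Qed.

Lemma res_word w k : (k < n)%N ->
  res (word_res w) k.+1 =
    if w k.+1 then kappa2 - (leg_count w k)%:R
    else kappa1 + (k - leg_count w k)%:R.
Proof. exact: (res_tuple (fun k => if w k.+1 then _ else _)). Qed.

Lemma word_res_initial : (m <= n)%N ->
  word_res (fun p => p <= m)%N = hook_res n kappa1 kappa2 m.
Proof.
move=> mn; apply: eq_from_tnth => k; rewrite !tnth_mktuple leg_count_initial.
by case: ltnP.
Qed.

Lemma word_res_swap k w : (1 <= k < n)%N -> w k -> ~~ w k.+1 ->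
  word_res (swap k w) = swap_res k (word_res w).
Proof.
move=> kn wk /negbTE wk1; apply: eq_from_tnth => i; rewrite !tnth_mktuple /=.
case: k kn wk wk1 => // k kn wk wk1; have iP := ltn_ord i.
case: eqP => [[->]|ik].
  rewrite res_word ?swap_l ?wk1 ?leg_count_swap ?leg_countS ?wk //; try lia.
  by congr (_ + _%:R); lia.
case: eqP => [[->]|ik1].
  rewrite res_word ?swap_r ?wk //; last by lia.
  rewrite leg_countS swap_l wk1 addn0 leg_count_swap //; lia.
rewrite res_word // swap_out ?leg_count_swap //; lia.
Qed.

(** By induction: moving the idempotent past [psi k] turns the residue sequence of [w] into that of
    [swap k w]. *)
Lemma vec_e w : hook_word n m w -> E (word_res w) *: vec w = vec w.
Proof.
have [N] := ubnP (sumn (legs n w)).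
elim: N w => // N IH w; rewrite ltnS => wN hw.
have [->|[k [kn wk wk1]]] := hook_word_initial_or hw.
  have mn := hook_word_le hw; by rewrite vec_initial // word_res_initial.
rewrite (vec_pred kn wk wk1) scalerA.
have {1}-> : word_res w = swap_res k (word_res (swap k w)).
  by rewrite -word_res_swap ?swapK ?swap_l ?swap_r.
rewrite -(klr_family_psie klrP) // -scalerA IH //; last exact: hook_word_swap.
exact: leq_trans (legs_swap_sumn kn wk wk1) wN.
Qed.

(** For [LA] at [l] and [l.+1], the residue of the arm node minus that of the leg node is
    [delta l - 1]. The number of earlier legs cancels, so every residue condition depends on the
    position alone. *)
Definition delta (l : nat) : 'Z_e := l%:R + kappa1 - kappa2.

Lemma Ze_one_neq0 : (1 : 'Z_e) != 0.
Proof. by []. Qed.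

(** Here [3 <= e] enters; it keeps the cases [delta l = 0] and [delta l = 2] apart. *)
Lemma Ze_two_neq0 : (2%:R : 'Z_e) != 0.
Proof. by case: e e3 => [|[|[|k]]]. Qed.

Lemma deltaS l : delta l.+1 = delta l + 1.
Proof. by rewrite /delta; ring. Qed.

Lemma deltaS1 l : (delta l.+1 == 1) = (delta l == 0).
Proof. by rewrite deltaS -subr_eq0 addrK. Qed.

Lemma deltaS2 l : (delta l.+1 == 2%:R) = (delta l == 1).
Proof. by rewrite deltaS -subr_eq0 -[RHS]subr_eq0; congr (_ == 0); ring. Qed.

Lemma deltaSS0 l : delta l = 0 -> (delta l.+2 == 0) = false.
Proof. by move=> d0; rewrite !deltaS d0 add0r; apply/negbTE/Ze_two_neq0. Qed.

Lemma delta0_neq2 l : delta l = 0 -> (delta l == 2%:R) = false.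
Proof. by move=> ->; rewrite eq_sym; apply/negbTE/Ze_two_neq0. Qed.

Lemma delta0_neq1 l : delta l = 0 -> (delta l == 1) = false.
Proof. by move=> ->; rewrite eq_sym; apply/negbTE/Ze_one_neq0. Qed.

Lemma delta1_neq2 l : delta l = 1 -> (delta l == 2%:R) = false.
Proof.
move=> ->; apply/negbTE; rewrite -subr_eq0 -oppr_eq0.
by rewrite [X in X == 0](_ : _ = 1) ?Ze_one_neq0 //; ring.
Qed.

(** * Residues at neighbouring positions *)

Section Residues.
Variables (k : nat) (w : nat -> bool).
Hypothesis kn : (1 <= k)%N.

Lemma res_leg : (k <= n)%N -> w k ->
  res (word_res w) k = kappa2 - (leg_count w k.-1)%:R.
Proof. by case: k kn => // j _ jn wj; rewrite res_word // wj. Qed.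

Lemma res_arm : (k <= n)%N -> ~~ w k ->
  res (word_res w) k = kappa1 + k%:R - 1 - (leg_count w k.-1)%:R.
Proof.
case: k kn => // j _ jn /negbTE wj; rewrite res_word // wj /=.
by rewrite natrB ?leg_count_le // -natr1; ring.
Qed.

Lemma leg_count_leg : w k -> leg_count w k = (leg_count w k.-1).+1.
Proof. by case: k kn => // j _ wj; rewrite leg_countS wj addn1. Qed.

End Residues.

Section LegArmResidues.
Variables (k : nat) (w : nat -> bool).
Hypotheses (kn : (1 <= k < n)%N) (wk : w k) (wk1 : ~~ w k.+1).

Let res_k : res (word_res w) k = kappa2 - (leg_count w k.-1)%:R.
Proof. by apply: res_leg => //; lia. Qed.
Let res_k1 :
  res (word_res w) k.+1 = kappa1 + k%:R - 1 - (leg_count w k.-1)%:R.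
Proof.
rewrite res_arm //=; last by lia.
by rewrite (@leg_count_leg k) //; [ring | lia].
Qed.

Lemma res_eq_LA :
  (res (word_res w) k == res (word_res w) k.+1) = (delta k == 1).
Proof.
rewrite res_k res_k1 /delta -subr_eq0 -[RHS]subr_eq0 -oppr_eq0.
by congr (_ == 0); ring.
Qed.

Lemma arrow_LA :
  arrow (res (word_res w) k) (res (word_res w) k.+1) = (delta k == 2%:R).
Proof.
rewrite /arrow res_k res_k1 /delta -subr_eq0 -[RHS]subr_eq0.
by congr (_ == 0); ring.
Qed.

Lemma arrow_AL :
  arrow (res (word_res w) k.+1) (res (word_res w) k) = (delta k == 0).
Proof.
rewrite /arrow res_k res_k1 /delta -subr_eq0 -oppr_eq0.
by congr (_ == 0); ring.
Qed.
End LegArmResidues.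

(** The value to be proved for [psi l] on [vec w], by the letters [LL], [LA], [AL], [AA] at [l] and
    [l.+1]. The letters at [l.-1] and [l.+2] enter where an [A] or an [L] jumps over two letters, in
    [ALL] and [AAL]. *)
Definition psi_image l w : M :=
  if w l then
    if w l.+1 then
      if (delta l == 2%:R) && ~~ w l.-1 then vec (swap l (swap l.-1 w)) else 0
    else vec (swap l w)
  else if w l.+1 then
    if delta l == 0 then
      if w l.+2 then vec (swap l.+1 (swap l w)) else 0
    else if delta l == 1 then 0
    else if delta l == 2%:R then
      if w l.-1 then 0 else - vec (swap l.-1 (swap l w))
    else vec (swap l w)
  else if (delta l == 0) && w l.+2 then - vec (swap l (swap l.+1 w)) else 0.

(** As [delta r = 2] means [delta r.-1 = 1], both nonzero branches concern an [AL] starting where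
    [delta] is 1, with [r] its left or its right end. *)
Definition y_image r w : M :=
  if [&& delta r == 1, ~~ w r & w r.+1] then - vec (swap r w)
  else if [&& delta r == 2%:R, ~~ w r.-1 & w r] then vec (swap r.-1 w)
  else 0.

(** Both formulas go through one induction: the quadratic relation calls for values of [y], and
    moving [y] past [psi] leaves values of [psi] to compute. *)
Definition action_at w : Prop :=
  (forall l, (1 <= l < n)%N -> psi l *: vec w = psi_image l w) /\
  (forall r, (1 <= r <= n)%N -> y r *: vec w = y_image r w).

Definition word_lt u w := (sumn (legs n u) < sumn (legs n w))%N.

Lemma hook_word_in w p : hook_word n m w -> w p -> (p <= n)%N.
Proof. by case=> _ out _; rewrite leqNgt; apply: contraL => /out->. Qed.

Lemma hook_word_gt0 w p : hook_word n m w -> ~~ w p -> (0 < p)%N.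
Proof. by case=> w0 _ _; case: p => //; rewrite w0. Qed.

Lemma hook_word_down w k : hook_word n m w -> ~~ w k -> w k.+1 ->
  [/\ (1 <= k < n)%N, hook_word n m (swap k w) & word_lt (swap k w) w].
Proof.
move=> hw wk wk1; have kn : (1 <= k < n)%N.
  by rewrite (hook_word_gt0 hw wk) (hook_word_in hw wk1).
by split=> //; [apply: hook_word_swap | apply: legs_swap_sumn].
Qed.

Lemma word_lt_trans : transitive word_lt.
Proof. by move=> v u w; apply: ltn_trans. Qed.

(** * Quadratic and braid relations on words *)

Section LegArmVector.
Variables (k : nat) (w : nat -> bool).
Hypotheses (hw : hook_word n m w) (kn : (1 <= k < n)%N).
Hypotheses (wk : w k) (wk1 : ~~ w k.+1).

Lemma y_vec_swap : y k *: vec (swap k w) =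
  psi k *: (y k.+1 *: vec w) - vec w *+ (delta k == 1).
Proof. by rewrite -psi_vec // (y_psiA klrP kn (vec_e hw)) res_eq_LA. Qed.

Lemma yS_vec_swap : y k.+1 *: vec (swap k w) =
  psi k *: (y k *: vec w) + vec w *+ (delta k == 1).
Proof. by rewrite -psi_vec // (yS_psiA klrP kn (vec_e hw)) res_eq_LA. Qed.

Lemma psi_vec_swap : psi k *: vec (swap k w) =
  if delta k == 1 then 0
  else if delta k == 2%:R then y k.+1 *: vec w - y k *: vec w
  else if delta k == 0 then y k *: vec w - y k.+1 *: vec w
  else vec w.
Proof.
by rewrite -psi_vec // (psi2A klrP kn (vec_e hw)) res_eq_LA ?arrow_LA ?arrow_AL.
Qed.
End LegArmVector.

(** The residue at [k.+2] exceeds that at [k] by [delta k]. When this is 0 the arrow points from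
    [k.+1] to [k], whence the minus sign. *)
Lemma braid_LAA k w : hook_word n m w -> (1 <= k)%N -> (k.+1 < n)%N ->
  w k -> ~~ w k.+1 -> ~~ w k.+2 ->
  psi k *: (psi k.+1 *: (psi k *: vec w)) =
    psi k.+1 *: (psi k *: (psi k.+1 *: vec w)) +
    if delta k == 0 then - vec w else 0.
Proof.
move=> hw k1 kn wk wk1 wk2; rewrite (braidA klrP k1 kn (vec_e hw)).
congr (_ + _).
have kn' : (1 <= k < n)%N by lia.
rewrite arrow_LA // arrow_AL //.
have -> : (res (word_res w) k.+2 == res (word_res w) k) = (delta k == 0).
  rewrite res_arm // res_leg //=; last by lia.
  rewrite leg_countS (negbTE wk1) addn0 (@leg_count_leg k) // -subr_eq0.
  by congr (_ == 0); rewrite /delta; ring.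
by case: eqP => // /delta0_neq2 ->.
Qed.

(** Residues drop by one down the leg, so the arrow always points from [k.+1] to [k]; the residues
    at [k] and [k.+2] agree exactly when [delta k = 1]. *)
Lemma braid_LLA k w : hook_word n m w -> (1 <= k)%N -> (k.+1 < n)%N ->
  w k -> w k.+1 -> ~~ w k.+2 ->
  psi k *: (psi k.+1 *: (psi k *: vec w)) =
    psi k.+1 *: (psi k *: (psi k.+1 *: vec w)) -
    if delta k == 1 then vec w else 0.
Proof.
move=> hw k1 kn wk wk1 wk2; rewrite (braidA klrP k1 kn (vec_e hw)).
congr (_ + _).
have resk : res (word_res w) k = kappa2 - (leg_count w k.-1)%:R.
  by apply: res_leg => //; lia.
have resk1 : res (word_res w) k.+1 = kappa2 - (leg_count w k.-1)%:R - 1.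
  rewrite res_leg //=; last by lia.
  by rewrite (@leg_count_leg k) //; ring.
have -> : (res (word_res w) k.+2 == res (word_res w) k) = (delta k == 1).
  rewrite res_arm // resk /=.
  rewrite leg_countS wk1 addn1 (@leg_count_leg k) // -subr_eq0 -[RHS]subr_eq0.
  by congr (_ == 0); rewrite /delta; ring.
have -> : arrow (res (word_res w) k) (res (word_res w) k.+1) = false.
  rewrite /arrow resk resk1 -subr_eq0 -oppr_eq0.
  by rewrite [X in X == 0](_ : _ = 2%:R) ?(negbTE Ze_two_neq0) //; ring.
by rewrite /arrow resk resk1 subrK eqxx; case: ifP; rewrite ?oppr0.
Qed.

(* [lia] would branch on every hypothesis about a letter of a word. *)
Ltac index_lia :=
  repeat match goal with
  | H : is_true ?b |- _ =>
      lazymatch b with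
      | leq _ _ => fail
      | andb (leq _ _) _ => fail
      | orb (leq _ _) _ => fail
      | negb (eq_op _ _) => fail
      | _ => clear H
      end
  | H : @eq bool _ _ |- _ => clear H
  end; lia.

(** The vector is [z]. Every nonzero branch of the two images other than [LA] needs an [A] before an
    [L], and [LA] occurs only at [m], where [psi] does not annihilate [z] by definition. *)
Lemma action_initial : (m <= n)%N -> action_at (fun p => p <= m)%N.
Proof.
move=> mn; split=> [l ln|r rn]; last first.
  rewrite vec_initial // z_y // /y_image.
  have -> : ~~ (r <= m)%N && (r < m)%N = false by lia.
  by have -> : ~~ (r.-1 <= m)%N && (r <= m)%N = false; [lia | rewrite !andbF].
have [lm|lm] := eqVneq l m; last first.
  rewrite vec_initial // z_psi // /psi_image.
  case: (leqP l m) => lm'.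
    have -> : (l < m)%N by lia.
    have -> : (l.-1 <= m)%N by lia.
    by rewrite andbF.
  have -> : (l < m)%N = false by lia.
  have -> : (l.+1 < m)%N = false by lia.
  by rewrite andbF.
have ml : (l <= m)%N by rewrite lm.
have ml1 : ~~ (l < m)%N by rewrite lm ltnn.
by rewrite psi_vec // /psi_image ml (negbTE ml1).
Qed.

(** * The inductive step, pattern by pattern *)

Section InductiveStep.
Variable w : nat -> bool.
Hypothesis hw : hook_word n m w.
Hypothesis IH : forall u, hook_word n m u -> word_lt u w -> action_at u.

(** With [vec w = psi k *: vec u] and [u] smaller, [y r] is moved past [psi k]. By induction [psi k]
    kills whatever arises besides the expected term. *)
Lemma y_action_step r : (1 <= r <= n)%N -> y r *: vec w = y_image r w.
Proof.
move=> rn; have [w_init|[k [kn wk wk1]]] := hook_word_initial_or hw.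
  have mn := hook_word_le hw.
  by rewrite w_init; apply: (action_initial mn).2.
have [_ hu uw] := hook_word_down hw wk wk1.
pose u := swap k w; rewrite -/u in hu uw.
have uk : u k by rewrite /u swap_l.
have uk1 : ~~ u k.+1 by rewrite /u swap_r.
have wE : w = swap k u by rewrite /u swapK.
have [_ yu] := IH hu uw.
have down t : ~~ u t -> u t.+1 -> action_at (swap t u).
  by move=> ut ut1; have [_ ? ?] := hook_word_down hu ut ut1; apply: IH => //;
     apply: word_lt_trans uw.
have k0 : (0 < k)%N by index_lia.
(* [y k.+1] now acts on [vec u]. If [delta k = 0] it may turn [LAL] from [k] on into [LLA], which
   [psi k] kills because [delta k] is not 2. *)
have [rk|rk] := eqVneq r k.
  subst r; rewrite {1}wE y_vec_swap // yu; last by index_lia.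
  rewrite /y_image (negbTE wk) wk1 (negbTE uk1) !andbF /= andbT deltaS1.
  case: eqP => [d0|_] /=; last first.
    by rewrite scaler0 sub0r; case: ifP; rewrite ?oppr0.
  rewrite delta0_neq1 // subr0.
  case: ifP => uk2; last by rewrite scaler0.
  rewrite scalerN (down _ _ _).1 //.
  have -> : psi_image k (swap k.+1 u) = 0; last by rewrite oppr0.
  rewrite /psi_image swap_l uk2 swap_out ?uk ?delta0_neq2 //; index_lia.
(* [y k] now acts on [vec u]. If [delta k = 2] it may turn [ALA] from [k.-1] on into [LAA], which
   [psi k] kills because [delta k] is not 0. *)
have [rk1|rk1] := eqVneq r k.+1.
  subst r; rewrite {1}wE yS_vec_swap // yu; last by index_lia.
  rewrite /y_image wk1 /= wk uk !andbF /= !andbT deltaS2.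
  case: eqP => [d2|_] /=; last by rewrite scaler0 add0r; case: ifP.
  have d1 : (delta k == 1) = false.
    by apply/eqP => /delta1_neq2; rewrite d2 eqxx.
  rewrite d1 addr0; case: ifP => uk2; last by rewrite scaler0.
  have kk : k.-1.+1 = k by index_lia.
  rewrite (down _ _ _).1 ?kk //.
  rewrite /psi_image -{1}[k in swap _ _ k]kk swap_r (negbTE uk2).
  rewrite swap_out ?(negbTE uk1); try index_lia.
  by case: eqP => // /delta0_neq2; rewrite d2 eqxx.
rewrite {1}(vec_pred kn wk wk1) -/u (psi_y_commA klrP) ?yu //; try index_lia.
(* A swap away from [k] and [k.+1] commutes with the swap at [k], so it carries over from [u] to
   [w]. *)
have far t : (t.+1 < k)%N || (k.+1 < t)%N -> ~~ u t -> u t.+1 ->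
    psi k *: vec (swap t u) = vec (swap t w).
  move=> tk ut ut1; rewrite psi_vec //.
  - by rewrite swapC -?wE //; index_lia.
  - by rewrite swap_out //; index_lia.
  - by rewrite swap_out //; index_lia.
rewrite /y_image.
have ur : u r = w r by rewrite /u swap_out.
case: ifP => [/and3P[/eqP d1 ur0 ur1]|c1].
  (* In this case [ALA] from [r] on has become [LAA], which [psi k] kills since [delta k = 2]. *)
  have [rk2|rk2] := eqVneq r.+1 k.
    have -> : w r.+1 = false by rewrite rk2; apply/negbTE.
    rewrite !andbF (delta1_neq2 d1) /=.
    rewrite scalerN (down _ _ _).1 // /psi_image -rk2 swap_r (negbTE ur0).
    rewrite swap_out ?rk2 ?(negbTE uk1); try index_lia.
    by rewrite -rk2 deltaS d1 (negbTE Ze_two_neq0) oppr0.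
  have -> : w r.+1 by rewrite /u swap_out // in ur1; index_lia.
  rewrite d1 eqxx -ur ur0 /= scalerN far //; index_lia.
have -> : [&& delta r == 1, ~~ w r & w r.+1] = false.
  apply: contraFF c1; rewrite -ur => /and3P[-> -> wr1] /=.
  have rk2 : r.+1 != k by apply: contraNneq wk => <-.
  by rewrite /u swap_out.
case: r rn rk rk1 ur {c1} => // r rn rk rk1 ur /=.
case: ifP => [/and3P[/eqP d2 ur0 ur1]|c2].
  (* In this case [LAL] from [k] on has become [LLA], which [psi k] kills since [delta k = 0]. *)
  have [rk2|rk2] := eqVneq r k.+1.
    rewrite rk2 wk1 /= andbF -rk2.
    rewrite (down _ _ _).1 // /psi_image swap_out ?uk; try index_lia.
    rewrite rk2 swap_l -rk2 ur1.
    case: eqP => // d; move: d2; rewrite rk2 !deltaS d => /eqP.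
    by rewrite -addrA -subr_eq0 addrAC subrr add0r (negbTE Ze_two_neq0).
  have -> : w r = false.
    by apply/negbTE; rewrite /u swap_out // in ur0; index_lia.
  rewrite d2 eqxx -ur ur1 /= far //; index_lia.
rewrite scaler0; case: ifP => // /and3P[d2 wr0 wr1].
move/negP: c2; case; rewrite d2 ur wr1 andbT /=.
have rk2 : r != k.+1 by apply: contraNneq wr0 => ->.
by rewrite /u swap_out.
Qed.

(** Since [vec w] is [psi l] applied to [vec u], the square of [psi l] acts on [vec u]. Of the two
    [y] terms only [y l.+1] can survive for [delta l = 0], and only [y l] for [delta l = 2]. *)
Lemma psi_action_AL l : ~~ w l -> w l.+1 -> psi l *: vec w = psi_image l w.
Proof.
move=> wl wl1; have [ln hu uw] := hook_word_down hw wl wl1.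
pose u := swap l w; rewrite -/u in hu uw.
have ul : u l by rewrite /u swap_l.
have ul1 : ~~ u l.+1 by rewrite /u swap_r.
have [_ yu] := IH hu uw.
rewrite (vec_pred ln wl wl1) -/u psi_vec // psi_vec_swap // !yu; try index_lia.
have ul2 : u l.+2 = w l.+2 by rewrite /u swap_out; index_lia.
have ulp : u l.-1 = w l.-1 by rewrite /u swap_out; index_lia.
rewrite /y_image /= ul (negbTE ul1) !(andbF, andbT) /= deltaS1 ul2 ulp.
rewrite /psi_image (negbTE wl) wl1 -/u.
case: eqP => [d1|_]; first by case: eqP d1 => // /delta0_neq1/eqP.
case: eqP => [d2|_]; last first.
  by case: eqP => // _ /=; rewrite sub0r; case: ifP; rewrite ?opprK ?oppr0.
have -> : (delta l == 0) = false by apply/eqP => /delta0_neq2; rewrite d2 eqxx.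
by rewrite sub0r; case: (w l.-1); rewrite ?oppr0.
Qed.

(* In the names below, A and L stand for entries of the arm and of the leg, read
   from position l on. v(AAL) = psi_(l+1) psi_l v(LAA), so the braid relation
   applies; away from AAL, psi_l commutes past the last psi_k of v. *)
Lemma psi_action_AAL l : ~~ w l -> ~~ w l.+1 -> w l.+2 ->
  psi l *: vec w = psi_image l w.
Proof.
move=> wl wl1 wl2; have [ln1 hu1 u1w] := hook_word_down hw wl1 wl2.
pose u1 := swap l.+1 w; rewrite -/u1 in hu1 u1w.
have u1l : ~~ u1 l by rewrite /u1 swap_out //; index_lia.
have u1l1 : u1 l.+1 by rewrite /u1 swap_l.
have u1l2 : ~~ u1 l.+2 by rewrite /u1 swap_r.
have [ln hu uu1] := hook_word_down hu1 u1l u1l1.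
pose u := swap l u1; rewrite -/u in hu uu1.
have ul : u l by rewrite /u swap_l.
have ul1 : ~~ u l.+1 by rewrite /u swap_r.
have ul2 : ~~ u l.+2 by rewrite /u swap_out //; index_lia.
have uw : word_lt u w := word_lt_trans uu1 u1w.
rewrite (vec_pred ln1 wl1 wl2) -/u1 (vec_pred ln u1l u1l1) -/u.
rewrite braid_LAA //; try index_lia.
rewrite /psi_image (negbTE wl) (negbTE wl1) wl2 andbT -/u1 -/u.
(* The other braid term vanishes. Read from [l.-1] on, it could survive two steps only along
   [ALAAL], [ALLAA], [LLAAA], with [delta l.+1 = 0] and [delta l = 2], hence [e = 3]; the last
   [psi l.+1] then meets [AAA]. *)
rewrite (_ : psi l.+1 *: _ = 0) ?add0r //.
rewrite (IH hu uw).1 // {1}/psi_image (negbTE ul1) (negbTE ul2).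
case: ifP => [/andP[/eqP d ul3]|_]; last by rewrite !scaler0.
have [_ ht1 t1u] := hook_word_down hu ul2 ul3.
pose t1 := swap l.+2 u; rewrite -/t1 in ht1 t1u *.
have t1l1 : ~~ t1 l.+1 by rewrite /t1 swap_out //; index_lia.
have t1l2 : t1 l.+2 by rewrite /t1 swap_l.
have t1l3 : ~~ t1 l.+3 by rewrite /t1 swap_r.
have t1l : t1 l by rewrite /t1 swap_out //; index_lia.
have [_ ht2 t2t1] := hook_word_down ht1 t1l1 t1l2.
pose t2 := swap l.+1 t1; rewrite -/t2 in ht2 t2t1 *.
have t2l : t2 l by rewrite /t2 swap_out //; index_lia.
have t2l1 : t2 l.+1 by rewrite /t2 swap_l.
have t2l2 : ~~ t2 l.+2 by rewrite /t2 swap_r.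
have t2l3 : ~~ t2 l.+3 by rewrite /t2 swap_out //; index_lia.
have t2w : word_lt t2 w by apply: word_lt_trans uw; apply: word_lt_trans t1u.
rewrite !scalerN (IH ht2 t2w).1 // /psi_image t2l t2l1.
case: ifP => [/andP[_ t2p]|_]; last by rewrite scaler0 oppr0.
have l0 : (0 < l)%N by index_lia.
have lp : l.-1.+1 = l by index_lia.
have [_ hs1 s1t2] := hook_word_down ht2 t2p (etrans (congr1 _ lp) t2l).
pose s1 := swap l.-1 t2; rewrite -/s1 in hs1 s1t2 *.
have s1l : ~~ s1 l by rewrite -lp /s1 swap_r.
have s1l1 : s1 l.+1 by rewrite /s1 swap_out //; index_lia.
have s1l2 : ~~ s1 l.+2 by rewrite /s1 swap_out //; index_lia.
have s1l3 : ~~ s1 l.+3 by rewrite /s1 swap_out //; index_lia.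
have [_ hs2 s2s1] := hook_word_down hs1 s1l s1l1.
pose s2 := swap l s1; rewrite -/s2 in hs2 s2s1 *.
have s2l1 : ~~ s2 l.+1 by rewrite /s2 swap_r.
have s2l2 : ~~ s2 l.+2 by rewrite /s2 swap_out //; index_lia.
have s2l3 : ~~ s2 l.+3 by rewrite /s2 swap_out //; index_lia.
have s2w : word_lt s2 w.
  by apply: word_lt_trans t2w; apply: word_lt_trans s1t2.
rewrite (IH hs2 s2w).1 // /psi_image (negbTE s2l1) (negbTE s2l2) (negbTE s2l3).
by rewrite andbF oppr0.
Qed.

Lemma psi_action_AA l : (1 <= l < n)%N -> ~~ w l -> ~~ w l.+1 ->
  psi l *: vec w = psi_image l w.
Proof.
move=> ln wl wl1; case wl2 : (w l.+2); first exact: psi_action_AAL.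
have [w_init|[k [kn wk wk1]]] := hook_word_initial_or hw.
  have mn := hook_word_le hw.
  by rewrite w_init; apply: (action_initial mn).1.
have far : (l.+1 < k)%N || (k.+1 < l)%N.
  have : k != l by apply: contraNneq wl1 => <-.
  have : k.+1 != l by apply: contraNneq wl => <-.
  have : k.+1 != l.+2 by apply: contraFneq wl2 => <-.
  index_lia.
have [_ hu uw] := hook_word_down hw wk wk1.
pose u := swap k w; rewrite -/u in hu uw.
have ul : ~~ u l by rewrite /u swap_out //; index_lia.
have ul1 : ~~ u l.+1 by rewrite /u swap_out //; index_lia.
rewrite (vec_pred kn wk wk1) -/u (psi_commA klrP) // (IH hu uw).1 //.
rewrite /psi_image (negbTE ul) (negbTE ul1) (negbTE wl) (negbTE wl1) wl2 andbF.
case: ifP => [/andP[/eqP d ul2]|_]; last by rewrite scaler0.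
(* The [L] at [l.+2] in [u] was put there by the swap. The surviving word reads [LAAA] from [l] on,
   and [psi l.+2] kills it because [delta l.+2 = 2] is not 0. *)
have kl : k = l.+2.
  apply/eqP; apply: contraTT ul2 => kl; rewrite /u swap_out ?wl2 //; index_lia.
subst k; have ul3 : ~~ u l.+3 by rewrite /u swap_r.
have [_ ht tu] := hook_word_down hu ul1 ul2.
pose t := swap l.+1 u; rewrite -/t in ht tu *.
have tl : ~~ t l by rewrite /t swap_out //; index_lia.
have tl1 : t l.+1 by rewrite /t swap_l.
have tl2 : ~~ t l.+2 by rewrite /t swap_r.
have tl3 : ~~ t l.+3 by rewrite /t swap_out //; index_lia.
have [_ hs st] := hook_word_down ht tl tl1.
pose s := swap l t; rewrite -/s in hs st *.
have sl2 : ~~ s l.+2 by rewrite /s swap_out //; index_lia.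
have sl3 : ~~ s l.+3 by rewrite /s swap_out //; index_lia.
have sw : word_lt s w.
  by apply: word_lt_trans uw; apply: word_lt_trans tu.
rewrite scalerN (IH hs sw).1 // /psi_image (negbTE sl2) (negbTE sl3).
by rewrite deltaSS0 // oppr0.
Qed.

(** From [l] on, [ALL] is obtained from [LLA] by [psi l.+1] and then [psi l]. The braid relation
    applies, and its correction term gives [LLA] when [delta l = 1]. *)
Lemma psi_action_ALL l : ~~ w l -> w l.+1 -> w l.+2 ->
  psi l.+1 *: vec w = psi_image l.+1 w.
Proof.
move=> wl wl1 wl2; have [ln hu1 u1w] := hook_word_down hw wl wl1.
pose u1 := swap l w; rewrite -/u1 in hu1 u1w.
have u1l : u1 l by rewrite /u1 swap_l.
have u1l1 : ~~ u1 l.+1 by rewrite /u1 swap_r.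
have u1l2 : u1 l.+2 by rewrite /u1 swap_out //; index_lia.
have [ln1 hu uu1] := hook_word_down hu1 u1l1 u1l2.
pose u := swap l.+1 u1; rewrite -/u in hu uu1.
have ul : u l by rewrite /u swap_out //; index_lia.
have ul1 : u l.+1 by rewrite /u swap_l.
have ul2 : ~~ u l.+2 by rewrite /u swap_r.
have uw : word_lt u w := word_lt_trans uu1 u1w.
rewrite (vec_pred ln wl wl1) -/u1 (vec_pred ln1 u1l1 u1l2) -/u.
have braid : psi l.+1 *: (psi l *: (psi l.+1 *: vec u)) =
    psi l *: (psi l.+1 *: (psi l *: vec u)) +
    if delta l == 1 then vec u else 0.
  by rewrite braid_LLA ?subrK //; index_lia.
rewrite braid /psi_image wl1 wl2 deltaS2 /= wl andbT -/u1 -/u.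
(* Read from [l.-1] on, this term could survive two steps only along [ALLAL], [LLAAL], [LLLAA]; the
   last [psi l] then meets [LLL] and gives 0. *)
rewrite (_ : psi l *: _ = 0) ?add0r //.
rewrite (IH hu uw).1 // {1}/psi_image ul ul1.
case: ifP => [/andP[/eqP d ulp]|_]; last by rewrite !scaler0.
have lp : l.-1.+1 = l by index_lia.
have ulp1 : u l.-1.+1 by rewrite lp.
have [_ ht1 t1u] := hook_word_down hu ulp ulp1.
pose t1 := swap l.-1 u; rewrite -/t1 in ht1 t1u *.
have t1p : t1 l.-1 by rewrite /t1 swap_l.
have t1l : ~~ t1 l by rewrite -lp /t1 swap_r.
have t1l1 : t1 l.+1 by rewrite /t1 swap_out //; index_lia.
have t1l2 : ~~ t1 l.+2 by rewrite /t1 swap_out //; index_lia.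
have [_ ht2 t2t1] := hook_word_down ht1 t1l t1l1.
pose t2 := swap l t1; rewrite -/t2 in ht2 t2t1 *.
have t2p : t2 l.-1 by rewrite /t2 swap_out //; index_lia.
have t2l : t2 l by rewrite /t2 swap_l.
have t2l1 : ~~ t2 l.+1 by rewrite /t2 swap_r.
have t2l2 : ~~ t2 l.+2 by rewrite /t2 swap_out //; index_lia.
have t2w : word_lt t2 w by apply: word_lt_trans uw; apply: word_lt_trans t1u.
rewrite (IH ht2 t2w).1 // /psi_image (negbTE t2l1) (negbTE t2l2).
case: ifP => [/andP[_ t2l3]|_]; last by rewrite scaler0.
have [_ hs1 s1t2] := hook_word_down ht2 t2l2 t2l3.
pose s1 := swap l.+2 t2; rewrite -/s1 in hs1 s1t2 *.
have s1p : s1 l.-1 by rewrite /s1 swap_out //; index_lia.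
have s1l : s1 l by rewrite /s1 swap_out //; index_lia.
have s1l1 : ~~ s1 l.+1 by rewrite /s1 swap_out //; index_lia.
have s1l2 : s1 l.+2 by rewrite /s1 swap_l.
have [_ hs2 s2s1] := hook_word_down hs1 s1l1 s1l2.
pose s2 := swap l.+1 s1; rewrite -/s2 in hs2 s2s1 *.
have s2p : s2 l.-1 by rewrite /s2 swap_out //; index_lia.
have s2l : s2 l by rewrite /s2 swap_out //; index_lia.
have s2l1 : s2 l.+1 by rewrite /s2 swap_l.
have s2w : word_lt s2 w.
  by apply: word_lt_trans t2w; apply: word_lt_trans s1t2.
by rewrite scalerN (IH hs2 s2w).1 // /psi_image s2l s2l1 s2p andbF oppr0.
Qed.

(** If the preceding letter is [A], the pattern is [ALL]. Otherwise it is [LLL], with [w 0]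
    supplying the first [L] at the left end, and every [AL] is far enough away for its [psi k] to
    commute. *)
Lemma psi_action_LL l : (1 <= l < n)%N -> w l -> w l.+1 ->
  psi l *: vec w = psi_image l w.
Proof.
case: l => // l ln wl wl1; case wp : (w l); last first.
  by apply: psi_action_ALL => //; rewrite wp.
have [w_init|[k [kn wk wk1]]] := hook_word_initial_or hw.
  have mn := hook_word_le hw.
  by rewrite w_init; apply: (action_initial mn).1.
have far : (l.+2 < k)%N || (k.+1 < l.+1)%N.
  have : k != l by apply: contraNneq wk => ->.
  have : k != l.+1 by apply: contraNneq wk => ->.
  have : k != l.+2 by apply: contraNneq wk => ->.
  index_lia.
have [_ hu uw] := hook_word_down hw wk wk1.
pose u := swap k w; rewrite -/u in hu uw.
have ul : u l.+1 by rewrite /u swap_out //; index_lia.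
have ul1 : u l.+2 by rewrite /u swap_out //; index_lia.
rewrite (vec_pred kn wk wk1) -/u (psi_commA klrP) // (IH hu uw).1 //.
rewrite /psi_image ul ul1 wl wl1 /= wp andbF.
case: ifP => [/andP[/eqP d up]|_]; last by rewrite scaler0.
(* The [A] at [l] in [u] was put there by the swap. The surviving word reads [LLLA] from [k] on, and
   [psi k] kills it since [delta k.+2 = 2] forces [delta k = 0]. *)
have kl : k.+1 = l.
  apply/eqP; apply: contraNT up => kl; rewrite /u swap_out ?wp //; index_lia.
subst l; have uk : u k by rewrite /u swap_l.
have [_ ht tu] := hook_word_down hu up ul.
pose t := swap k.+1 u; rewrite -/t in ht tu *.
have tk : t k by rewrite /t swap_out //; index_lia.
have tk1 : t k.+1 by rewrite /t swap_l.
have tk2 : ~~ t k.+2 by rewrite /t swap_r.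
have tk3 : t k.+3 by rewrite /t swap_out //; index_lia.
have [_ hs st] := hook_word_down ht tk2 tk3.
pose s := swap k.+2 t; rewrite -/s in hs st *.
have sk : s k by rewrite /s swap_out //; index_lia.
have sk1 : s k.+1 by rewrite /s swap_out //; index_lia.
have sw : word_lt s w.
  by apply: word_lt_trans uw; apply: word_lt_trans tu.
rewrite (IH hs sw).1 // /psi_image sk sk1.
by move/eqP: d; rewrite deltaS2 => /eqP; rewrite deltaS => /eqP;
  rewrite -subr_eq0 addrK => /eqP/delta0_neq2->.
Qed.

Lemma action_step : action_at w.
Proof.
split=> [l ln|]; last exact: y_action_step.
case wl : (w l); case wl1 : (w l.+1).
- exact: psi_action_LL.
- by rewrite psi_vec ?wl1 // /psi_image wl wl1.
- by apply: psi_action_AL; rewrite ?wl.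
- by apply: psi_action_AA; rewrite ?wl ?wl1.
Qed.
End InductiveStep.

Theorem hook_action w : hook_word n m w -> action_at w.
Proof.
have [N] := ubnP (sumn (legs n w)).
elim: N w => // N IH w; rewrite ltnS => wN hw.
apply: action_step => // u hu uw; apply: IH => //.
exact: leq_trans uw wN.
Qed.

(** * Translation to tableaux *)

Section Cases.
Variables (l : nat) (a : seq nat).
Hypotheses (ln : (1 <= l < n)%N) (sa : sorted ltn a) (sz : size a = m).
Hypothesis ra : all (fun x => 1 <= x <= n)%N a.

Definition leg_vec (a : seq nat) : M := leg_product psi 1 a *: z.

Let w := leg_word a.

Let hw : hook_word n m w.
Proof. by rewrite -sz; apply: hook_leg_word. Qed.

Let legs_w : legs n w = a.
Proof. exact: legs_leg_word. Qed.

Let ua : uniq a.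
Proof. exact: sorted_uniq ltn_trans ltnn _ sa. Qed.

Let w_in p : p \in a -> w p.
Proof. by rewrite /w /leg_word => ->; rewrite orbT. Qed.

Let w_out p : (0 < p)%N -> p \notin a -> ~~ w p.
Proof. by rewrite /w /leg_word; case: p => //= p _. Qed.

Let in_w p : (0 < p)%N -> w p -> p \in a.
Proof. by rewrite /w /leg_word; case: p. Qed.

Let psi_l : psi l *: leg_vec a = psi_image l w.
Proof. by rewrite -{1}legs_w; apply: (hook_action hw).1. Qed.

Lemma vec_legs v : vec v = leg_vec (legs n v).
Proof. by []. Qed.

Lemma delta_eq0 : (delta l == 0) = (l%:R == kappa2 - kappa1).
Proof. by rewrite -[RHS]subr_eq0 /delta; congr (_ == 0); ring. Qed.

Lemma delta_eq2 : (delta l == 2%:R) = (l%:R == 2%:R + kappa2 - kappa1).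
Proof.
by rewrite -subr_eq0 -[RHS]subr_eq0 /delta; congr (_ == 0); ring.
Qed.

(** Here and in the next five lemmas the hypotheses fix the letters around [l] and so select a
    branch of [psi_image]; a window of two or three positions then identifies the resulting leg. *)
Lemma leg_vec_i r : case_i l a r ->
  psi l *: leg_vec a = leg_vec (replace_at a r [:: l + 1]%N).
Proof.
case=> rP rl rnext; rewrite psi_l.
have wl : w l by rewrite -rl; apply/w_in/entry_mem.
have wl1 : ~~ w l.+1.
  by apply: w_out => //; apply: gap_above sa rP rnext _; rewrite rl; lia.
rewrite /psi_image wl (negbTE wl1) vec_legs.
have [|||x [c]] := @legs_window n l 2 w (swap l w); try by index_lia.
  by move=> p pP; rewrite swap_out //; index_lia.
rewrite legs_w /= swap_l swap_r wl (negbTE wl1) /= => -[aE ->].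
by rewrite (replace_at1 _ aE) ?rl ?addn1 ?addn2.
Qed.

Lemma leg_vec_ii_pair r : case_ii_pair n kappa1 kappa2 l a r ->
  psi l *: leg_vec a = leg_vec (replace_at a r [:: l; l + 1]%N).
Proof.
case=> /eqP; rewrite -delta_eq0 => d0 ln1 rP [rl rl1] rprev; rewrite psi_l.
have rP1 : (1 <= r <= size a)%N by lia.
have wl1 : w l.+1 by apply: w_in; rewrite -addn1 -rl entry_mem.
have wl2 : w l.+2 by apply: w_in; rewrite -addn2 -rl1 entry_mem; lia.
have wl : ~~ w l.
  apply: w_out; first by index_lia.
  by apply: gap_below sa rP1 rprev _; rewrite rl; index_lia.
rewrite /psi_image (negbTE wl) wl1 wl2 d0 vec_legs.
have [|||x [c]] := @legs_window n l 3 w (swap l.+1 (swap l w));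
  try by index_lia.
  by move=> p pP; rewrite !swap_out //; index_lia.
have w'l : swap l.+1 (swap l w) l = w l.+1.
  by rewrite swap_out ?swap_l //; index_lia.
have w'l2 : swap l w l.+2 = w l.+2 by rewrite swap_out //; index_lia.
rewrite legs_w /= w'l swap_l w'l2 swap_r swap_r.
rewrite (negbTE wl) wl1 wl2 /= => -[aE ->].
by rewrite (replace_at2 _ _ aE) ?rl ?addn1 ?addn2.
Qed.

Lemma leg_vec_ii_single r : case_ii_single n kappa1 kappa2 l a r ->
  psi l *: leg_vec a = - leg_vec (replace_at a r [:: l]).
Proof.
case=> /eqP; rewrite -delta_eq0 => d0 ln1 rP rl rprev; rewrite psi_l.
have wl2 : w l.+2 by apply: w_in; rewrite -addn2 -rl entry_mem.
have wl : ~~ w l.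
  apply: w_out; first by index_lia.
  by apply: gap_below sa rP rprev _; rewrite rl; index_lia.
have wl1 : ~~ w l.+1.
  by apply: w_out => //; apply: gap_below sa rP rprev _; rewrite rl; index_lia.
rewrite /psi_image (negbTE wl) (negbTE wl1) wl2 d0 vec_legs.
congr (- leg_vec _).
have [|||x [c]] := @legs_window n l 3 w (swap l (swap l.+1 w));
  try by index_lia.
  by move=> p pP; rewrite !swap_out //; index_lia.
have w'l2 : swap l (swap l.+1 w) l.+2 = w l.+1.
  by rewrite swap_out ?swap_r //; index_lia.
have w'l : swap l.+1 w l = w l by rewrite swap_out //; index_lia.
rewrite legs_w /= w'l2 swap_l swap_l swap_r w'l.
rewrite (negbTE wl) (negbTE wl1) wl2 /= => -[aE ->].
by rewrite (replace_at1 _ aE) ?rl ?addn1 ?addn2.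
Qed.

Lemma leg_vec_iii_pair r : case_iii_pair kappa1 kappa2 l a r ->
  psi l *: leg_vec a = leg_vec (replace_at a r [:: l - 1; l]%N).
Proof.
case=> /eqP; rewrite -delta_eq2 => d2 l2 rP [rl rl1] rprev; rewrite psi_l.
have rP1 : (1 <= r <= size a)%N by lia.
have wl : w l by apply: w_in; rewrite -rl entry_mem.
have wl1 : w l.+1 by apply: w_in; rewrite -addn1 -rl1 entry_mem; lia.
have wlp : ~~ w l.-1.
  apply: w_out; first by index_lia.
  by apply: gap_below sa rP1 rprev _; rewrite rl; index_lia.
rewrite /psi_image wl wl1 wlp d2 vec_legs subn1; congr leg_vec.
(* The window starts at [l.-1], so [l] is written as a successor. *)
have [k lE] : exists k, l = k.+1 by exists l.-1; index_lia.
rewrite lE /= in wl wl1 wlp rl *.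
have [|||x [c]] := @legs_window n k 3 w (swap k.+1 (swap k w));
  try by index_lia.
  by move=> p pP; rewrite !swap_out //; index_lia.
have w'k : swap k.+1 (swap k w) k = w k.+1.
  by rewrite swap_out ?swap_l //; index_lia.
have w'k2 : swap k w k.+2 = w k.+2 by rewrite swap_out //; index_lia.
rewrite legs_w /= w'k swap_l w'k2 swap_r swap_r.
rewrite (negbTE wlp) wl wl1 /= => -[aE ->].
by rewrite (replace_at2 _ _ aE) ?rl ?addn1 ?addn2.
Qed.

Lemma leg_vec_iii_single r : case_iii_single kappa1 kappa2 l a r ->
  psi l *: leg_vec a = - leg_vec (replace_at a r [:: l - 1]%N).
Proof.
case=> /eqP; rewrite -delta_eq2 => d2 l2 rP rl rprev; rewrite psi_l.
have wl1 : w l.+1 by apply: w_in; rewrite -addn1 -rl entry_mem.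
have wl : ~~ w l.
  apply: w_out; first by index_lia.
  by apply: gap_below sa rP rprev _; rewrite rl; index_lia.
have wlp : ~~ w l.-1.
  apply: w_out; first by index_lia.
  by apply: gap_below sa rP rprev _; rewrite rl; index_lia.
have d0 : (delta l == 0) = false by apply/eqP => /delta0_neq2; rewrite d2.
have d1 : (delta l == 1) = false by apply/eqP => /delta1_neq2; rewrite d2.
rewrite /psi_image (negbTE wl) wl1 (negbTE wlp) d0 d1 d2 vec_legs subn1.
congr (- leg_vec _).
have [k lE] : exists k, l = k.+1 by exists l.-1; index_lia.
rewrite lE /= in wl wl1 wlp rl *.
have [|||x [c]] := @legs_window n k 3 w (swap k (swap k.+1 w));
  try by index_lia.
  by move=> p pP; rewrite !swap_out //; index_lia.
have w'k2 : swap k (swap k.+1 w) k.+2 = w k.+1.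
  by rewrite swap_out ?swap_r //; index_lia.
have w'k : swap k.+1 w k = w k by rewrite swap_out //; index_lia.
rewrite legs_w /= swap_l swap_l swap_r w'k w'k2.
rewrite (negbTE wl) (negbTE wlp) wl1 /= => -[aE ->].
by rewrite (replace_at1 _ aE) ?rl ?addn1 ?addn2.
Qed.

Lemma leg_vec_iv r : case_iv kappa1 kappa2 l a r ->
  psi l *: leg_vec a = leg_vec (replace_at a r [:: l]).
Proof.
case=> dl rP rl rprev; rewrite psi_l.
have wl1 : w l.+1 by apply: w_in; rewrite -addn1 -rl entry_mem.
have wl : ~~ w l.
  apply: w_out; first by index_lia.
  by apply: gap_below sa rP rprev _; rewrite rl; index_lia.
move: dl; rewrite -/(delta l) !inE !negb_or => /and3P[d0 d1 d2].
rewrite /psi_image (negbTE wl) wl1 (negbTE d0) (negbTE d1) (negbTE d2) vec_legs.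
have [|||x [c]] := @legs_window n l 2 w (swap l w); try by index_lia.
  by move=> p pP; rewrite swap_out //; index_lia.
rewrite legs_w /= swap_l swap_r wl1 (negbTE wl) /= => -[aE ->].
by rewrite (replace_at1 _ aE) ?rl ?addn1 ?addn2.
Qed.

(** Each nonzero branch of [psi_image] produces an index [r] for one of the excluded cases. *)
Lemma leg_vec_0 :
  ~ (exists r, case_i l a r
       \/ case_ii_pair n kappa1 kappa2 l a r
       \/ case_ii_single n kappa1 kappa2 l a r
       \/ case_iii_pair kappa1 kappa2 l a r
       \/ case_iii_single kappa1 kappa2 l a r
       \/ case_iv kappa1 kappa2 l a r) ->
  psi l *: leg_vec a = 0.
Proof.
move=> none; rewrite psi_l /psi_image.
have l0 : (0 < l)%N by lia.
case wl : (w l); case wl1 : (w l.+1).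
- case: ifP => // /andP[d2 wlp]; case: none.
  have [r rP rl] := mem_entry (in_w l0 wl).
  have [rsz rl1] := entry_succ sa rP rl (in_w (ltn0Sn _) wl1).
  exists r; do 3!right; left; split.
  + by apply/eqP; rewrite -delta_eq2.
  (* As [w 0] is [L], an [A] at [l.-1] gives [2 <= l]. *)
  + by have := hook_word_gt0 hw wlp; lia.
  + lia.
  + by rewrite addn1.
  have [?|[lt_rp /w_in wrp]] := entry_prev sa rP; [by left | right].
  have : entry a r.-1 != l.-1 by apply: contraNneq wlp => <-.
  by rewrite rl in lt_rp; index_lia.
- case: none; have [r rP rl] := mem_entry (in_w l0 wl).
  exists r; left; split=> //.
  have [?|[lt_rn /w_in wrn]] := entry_next sa rP; [by left | right].
  have : entry a r.+1 != l.+1 by apply: contraFneq wl1 => <-.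
  by rewrite rl in lt_rn; index_lia.
- have [r rP rl1] := mem_entry (in_w (ltn0Sn _) wl1).
  have prev : r = 1 \/ (entry a r.-1 <= l - 1)%N.
    have [?|[lt_rp /w_in wrp]] := entry_prev sa rP; [by left | right].
    have : entry a r.-1 != l by apply: contraFneq wl => <-.
    by rewrite rl1 in lt_rp; index_lia.
  case: ifP => d0.
    case: ifP => // wl2; case: none.
    have [rsz rl2] := entry_succ sa rP rl1 (in_w (ltn0Sn _) wl2).
    exists r; right; left; split=> //.
    + by apply/eqP; rewrite -delta_eq0.
    (* No [L] occurs beyond [n], so an [L] at [l.+2] gives [l < n - 1]. *)
    + by have := hook_word_in hw wl2; lia.
    + lia.
    by rewrite addn1 addn2.
  case: ifP => // d1; case: ifP => d2.
    case: ifP => // /negbT wlp; case: none.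
    exists r; do 4!right; left; split=> //.
    + by apply/eqP; rewrite -delta_eq2.
    + by have := hook_word_gt0 hw wlp; lia.
    + by rewrite addn1.
    have [?|[lt_rp /w_in wrp]] := entry_prev sa rP; [by left | right].
    have np : entry a r.-1 != l.-1 by apply: contraNneq wlp => <-.
    have nl : entry a r.-1 != l by apply: contraFneq wl => <-.
    by rewrite rl1 in lt_rp; index_lia.
  case: none; exists r; do 5!right; split=> //; last by rewrite addn1.
  by rewrite -/(delta l) !inE d0 d1 d2.
- case: ifP => // /andP[d0 wl2]; case: none.
  have [r rP rl2] := mem_entry (in_w (ltn0Sn _) wl2).
  exists r; do 2!right; left; split=> //.
  + by apply/eqP; rewrite -delta_eq0.
  + by have := hook_word_in hw wl2; lia.
  + by rewrite addn2.
  have [?|[lt_rp /w_in wrp]] := entry_prev sa rP; [by left | right].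
  have nl1 : entry a r.-1 != l.+1 by apply: contraFneq wl1 => <-.
  have nl : entry a r.-1 != l by apply: contraFneq wl => <-.
  by rewrite rl2 in lt_rp; index_lia.
Qed.

End Cases.
End HookModule.


(** * The Specht module as an instance *)

Section SpechtGenerator.
Variables (F : fieldType) (e n : nat) (kappa1 kappa2 : 'Z_e) (m : nat).
Local Notation z := (specht_z F n kappa1 kappa2 m).

Lemma specht_z_e : klr_e F (hook_res n kappa1 kappa2 m) *: z = z.
Proof. by rewrite -[RHS]scale1r; apply/cyclic_gen_rel/specht_e. Qed.

Lemma specht_z_y r : (1 <= r <= n)%N -> klr_y F e n r *: z = 0.
Proof.
by move=> rn; rewrite -[RHS](scale0r z); apply/cyclic_gen_rel/specht_y.
Qed.

Lemma specht_z_psi r : (1 <= r < n)%N -> r != m -> klr_psi F e n r *: z = 0.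
Proof.
by move=> *; rewrite -[RHS](scale0r z); apply/cyclic_gen_rel/specht_psi.
Qed.

Lemma specht_v_leg_vec a :
  specht_v F n kappa1 kappa2 m a = leg_vec (klr_psi F e n) z a.
Proof.
rewrite /specht_v /leg_vec leg_productE add1n; congr (_ *: _).
by apply: eq_big_nat => j _; rewrite subn1.
Qed.
End SpechtGenerator.

Theorem theorem6p1 (F : fieldType) (e n : nat) (he : (3 <= e)%N)
    (hn : (1 <= n)%N) (kappa1 kappa2 : 'Z_e) (m l : nat)
    (hm : (0 <= m <= n)%N) (hl : (1 <= l <= n - 1)%N) (a : m.-tuple nat)
    (ha : sorted ltn a) (ha_range : all (fun x => (1 <= x <= n)%N) a) :
  let v : seq nat -> specht F n kappa1 kappa2 m :=
    specht_v F n kappa1 kappa2 m in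
  let psi_l : klr F e n := klr_psi F e n l in
  (forall r, case_i l a r -> psi_l *: v a = v (replace_at a r [:: l + 1]%N))
  /\ (forall r, case_ii_pair n kappa1 kappa2 l a r ->
        psi_l *: v a = v (replace_at a r [:: l; l + 1]%N))
  /\ (forall r, case_ii_single n kappa1 kappa2 l a r ->
        psi_l *: v a = - v (replace_at a r [:: l]))
  /\ (forall r, case_iii_pair kappa1 kappa2 l a r ->
        psi_l *: v a = v (replace_at a r [:: l - 1; l]%N))
  /\ (forall r, case_iii_single kappa1 kappa2 l a r ->
        psi_l *: v a = - v (replace_at a r [:: l - 1]%N))
  /\ (forall r, case_iv kappa1 kappa2 l a r ->
        psi_l *: v a = v (replace_at a r [:: l]))
  /\ (~ (exists r, case_i l a r
           \/ case_ii_pair n kappa1 kappa2 l a r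
           \/ case_ii_single n kappa1 kappa2 l a r
           \/ case_iii_pair kappa1 kappa2 l a r
           \/ case_iii_single kappa1 kappa2 l a r
           \/ case_iv kappa1 kappa2 l a r) ->
        psi_l *: v a = 0).
Proof.
have ln : (1 <= l < n)%N by lia.
rewrite (_ : specht_v F n kappa1 kappa2 m =
  leg_vec (klr_psi F e n) (specht_z F n kappa1 kappa2 m)); last first.
  by apply/funext => b; apply: specht_v_leg_vec.
have klrP := klr_is_family F e n.
have ze := specht_z_e F n kappa1 kappa2 m.
have zy := @specht_z_y F e n kappa1 kappa2 m.
have zp := @specht_z_psi F e n kappa1 kappa2 m.
have sz := size_tuple a.
move=> v psi_l.
split; last split; last split; last split; last split; last split.
- exact: leg_vec_i klrP ze zy zp he _ _ ln ha sz ha_range.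
- exact: leg_vec_ii_pair klrP ze zy zp he _ _ ln ha sz ha_range.
- exact: leg_vec_ii_single klrP ze zy zp he _ _ ln ha sz ha_range.
- exact: leg_vec_iii_pair klrP ze zy zp he _ _ ln ha sz ha_range.
- exact: leg_vec_iii_single klrP ze zy zp he _ _ ln ha sz ha_range.
- exact: leg_vec_iv klrP ze zy zp he _ _ ln ha sz ha_range.
- exact: leg_vec_0 klrP ze zy zp he _ _ ln ha sz ha_range.
Qed.
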